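(* There is an algorithm solving the Balanced Separator problem in time $2^{O(k\log k)}\cdot n^{O(1)}$, where $k=|T|$ and $n=|V(D)|$.
   Context: Balanced Separator: given a digraph $D$, a set $T\subseteq V(D)$ of size $k$, and non-negative integers $r$ and $s$, output a $(T,r)$-balanced separator $Z$ with $|Z|\le s$ if one exists (and report that none exists otherwise). A $(T,r)$-balanced separator is a set $Z\subseteq V(D)$ such that every strong component of $D\setminus Z$ contains at most $r$ vertices of $T$. *)

(* Defs.v *)
From mathcomp Require Import all_boot.

Set Implicit Arguments.
Unset Strict Implicit.
Unset Printing Implicit Defensive.

(* A digraph is a relation e on a finite type V of vertices. *)
Section BalancedSeparator.
Variables (V : finType) (e : rel V).
Implicit Types (T Z : {set V}) (r s : nat).

Definition del (Z : {set V}) : rel V :=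
  [rel u v | [&& u \notin Z, v \notin Z & e u v]].

Definition strongly_connected (Z : {set V}) : rel V :=
  [rel u v | connect (del Z) u v && connect (del Z) v u].

(* [connect] is reflexive on all of V, hence the explicit vertex set ~: Z. *)
Definition strong_components (Z : {set V}) : {set {set V}} :=
  equivalence_partition (strongly_connected Z) (~: Z).

Definition balanced_separator T r Z : bool :=
  [forall C in strong_components Z, #|C :&: T| <= r].

End BalancedSeparator.

(* Model of computation: first-order recursive programs on binary trees (the  *)
(* first-order variant of pure Lisp, as in N. D. Jones, Computability and     *)
(* Complexity from a Programming Perspective), each elementary step having    *)
(* unit cost.  A step reads a variable or a constant, allocates one cell,     *)
(* inspects one cell, binds a variable, or calls a function; trees are never  *)
(* copied or compared in one step, so that with trees held as pointers the    *)
(* running time is polynomially related to that of random access machines     *)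
(* and Turing machines.  The time bounds 2^O(k log k) * n^O(1) are closed     *)
(* under polynomials, hence independent of the choice among these models.     *)

Inductive tree := Leaf | Node of tree & tree.

(* Variables are de Bruijn indices. [ECase a b c] evaluates b if a yields     *)
(* Leaf, and c with the left and right subtrees bound to 0 and 1 otherwise.   *)
(* [ECall f a] calls the f-th function of the program, whose body sees its    *)
(* argument as its only variable.                                             *)
Inductive expr :=
| EVar of nat
| ELeaf
| ENode of expr & expr
| ECase of expr & expr & expr
| ELet of expr & expr
| ECall of nat & expr.

Definition program := seq expr.

(* [eval p env a v t]: in environment env, a evaluates to v in t steps. *)
Inductive eval (p : program) : seq tree -> expr -> tree -> nat -> Prop :=
| eval_var env i :
    eval p env (EVar i) (nth Leaf env i) 1
| eval_leaf env :
    eval p env ELeaf Leaf 1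
| eval_node env a b va vb ta tb :
    eval p env a va ta -> eval p env b vb tb ->
    eval p env (ENode a b) (Node va vb) (ta + tb).+1
| eval_case_leaf env a b c v ta tb :
    eval p env a Leaf ta -> eval p env b v tb ->
    eval p env (ECase a b c) v (ta + tb).+1
| eval_case_node env a b c x y v ta tc :
    eval p env a (Node x y) ta -> eval p [:: x, y & env] c v tc ->
    eval p env (ECase a b c) v (ta + tc).+1
| eval_let env a b va v ta tb :
    eval p env a va ta -> eval p (va :: env) b v tb ->
    eval p env (ELet a b) v (ta + tb).+1
| eval_call env f a va v ta tf :
    eval p env a va ta -> eval p [:: va] (nth ELeaf p f) v tf ->
    eval p env (ECall f a) v (ta + tf).+1.

(* Function 0 is the entry point. *)
Definition runs_in (p : program) (input output : tree) (t : nat) : Prop :=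
  eval p [:: input] (nth ELeaf p 0) output t.

Lemma eval_functional p env a v t v' t' :
  eval p env a v t -> eval p env a v' t' -> v = v' /\ t = t'.
Proof.
move=> ev; elim: ev v' t' => {env a v t}; intros;
  match goal with ev' : eval _ _ _ ?v' ?t' |- _ /\ _ = ?t' =>
    inversion ev'; subst; clear ev' end;
  repeat match goal with
    IH : (forall v t, eval ?p ?env ?a v t -> _), ev' : eval ?p ?env ?a _ _ |- _
      => case: (IH _ _ ev') => // ? ?; clear IH ev';
         try match goal with eqN : Node _ _ = Node _ _ |- _ =>
           case: eqN => ? ? end;
         subst
  end; by [].
Qed.

Fixpoint tree_of_nat (m : nat) : tree :=
  if m is m'.+1 then Node Leaf (tree_of_nat m') else Leaf.

Definition tree_of_seq (A : Type) (enc : A -> tree) (l : seq A) : tree :=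
  foldr (fun x => Node (enc x)) Leaf l.

Definition tree_of_vertices (n : nat) (l : seq 'I_n) : tree :=
  tree_of_seq (fun v : 'I_n => tree_of_nat v) l.

(* The list of the out-neighbourhoods of the vertices 0, ..., n - 1. *)
Definition tree_of_digraph (n : nat) (e : rel 'I_n) : tree :=
  tree_of_seq (fun u => tree_of_vertices (enum (e u))) (enum 'I_n).

(* Unary notation for r and s is harmless: a program need not traverse its    *)
(* whole input, and the time bound does not depend on the size of r and s.    *)
Definition instance (n : nat) (e : rel 'I_n) (T : {set 'I_n}) (r s : nat) :
    tree :=
  Node (tree_of_digraph e)
    (Node (tree_of_vertices (enum T)) (Node (tree_of_nat r) (tree_of_nat s))).

(* Leaf reports that there is no separator; Node Leaf z returns the set whose *)
(* elements are listed, in any order and without repetition, by z.            *)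
Definition correct_output (n : nat) (e : rel 'I_n) (T : {set 'I_n})
    (r s : nat) (out : tree) : Prop :=
  (exists (Z : {set 'I_n}) (zs : seq 'I_n),
     [/\ balanced_separator e T r Z, #|Z| <= s, perm_eq zs (enum Z)
       & out = Node Leaf (tree_of_vertices zs)])
  \/ ((~ exists Z : {set 'I_n}, balanced_separator e T r Z /\ #|Z| <= s)
      /\ out = Leaf).

(* f(k) = O(k log k), as k tends to infinity. *)
Definition bigO_klogk (f : nat -> nat) : Prop :=
  exists c k0 : nat, forall k, k0 <= k -> f k <= c * (k * trunc_log 2 k).

(* Main.v *)
Require Import Defs.
From HB Require Import structures.
From mathcomp Require Import all_boot zify.

Set Implicit Arguments.
Unset Strict Implicit.
Unset Printing Implicit Defensive.

(* In a solution, order the strong components that meet T topologically and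
   treat them one at a time, starting from a sink.  If S is the set of terminals
   of a sink component, the vertices reachable from S form a set R whose
   out-boundary is deleted and which avoids all other live terminals.  Pushing
   R outwards to a larger set with no larger boundary never hurts, since fewer
   vertices are left for the remaining components; so it suffices to branch
   over important separators.  A set A that is known to lie in R is enlarged
   greedily as long as the minimum size lam of a boundary does not grow; then
   for a vertex v on the boundary of A either v is deleted, so that the number z
   of deletions left drops by 1 and lam by at most 1, or v joins A, so that lam
   grows.  Hence 2 z - lam decreases, and z <= |T| because a solution larger
   than T can be replaced by T: the search has depth at most 5 |T| and degree at most
   2 |T| + 2, which gives the factor 2 ^ O(k log k).

   The number lam is found by bipartite matching: |W| - lam, for W the set of
   live terminals outside A, is the number of losers in an auction in which the
   vertices outside the closed out-neighbourhood of A bid for the vertices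
   outside A and W. *)

(** * Vertex cuts and balanced sets *)

Section Separation.
Variables (V : finType) (e : rel V).
Implicit Types (x y t u v : V) (R X U W A P Q : {set V}).

(** Reflexivity makes [nb] the closed out-neighbourhood, so that [cut U R] is the out-boundary of
    [R] in the graph induced on [U]. *)
Definition adj x y := (x == y) || e x y.
Definition nb R := [set y | [exists x in R, adj x y]].
Definition cut U R := (nb R :&: U) :\: R.

Lemma sub_nb R : R \subset nb R.
Proof.
by apply/subsetP => x xR; rewrite inE; apply/existsP; exists x; rewrite xR /adj eqxx.
Qed.

Lemma nbS R R' : R \subset R' -> nb R \subset nb R'.
Proof.
move=> /subsetP h; apply/subsetP => y; rewrite !inE => /existsP[x /andP[/h h1 h2]].
by apply/existsP; exists x; rewrite h1.
Qed.

Lemma nbU R R' : nb (R :|: R') = nb R :|: nb R'.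
Proof.
apply/eqP; rewrite eqEsubset subUset !nbS ?subsetUl ?subsetUr // !andbT.
apply/subsetP => y; rewrite !inE => /existsP[x /andP[]].
rewrite inE => /orP[] h1 h2; apply/orP; [left|right]; apply/existsP; exists x; by rewrite h1.
Qed.

Lemma card_cut U R : R \subset U -> #|cut U R| + #|R| = #|nb R :&: U|.
Proof.
move=> h; rewrite -(cardsID R (nb R :&: U)) addnC; congr (_ + _).
by apply: eq_card => x; rewrite !inE; case: (boolP (x \in R)) => xR;
  rewrite ?andbF // andbT (subsetP h) // andbT; have := subsetP (sub_nb R) x xR; rewrite inE.
Qed.

(** By [card_cut] only the sizes of [nb R :&: U] matter. There [nb] commutes with unions, and the
    [nb] of an intersection lies in the intersection of the two. *)
Lemma cut_submod U R R' : R \subset U -> R' \subset U ->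
  #|cut U (R :|: R')| + #|cut U (R :&: R')| <= #|cut U R| + #|cut U R'|.
Proof.
move=> h h'.
have hu : R :|: R' \subset U by rewrite subUset h.
have hi : R :&: R' \subset U by apply: subset_trans h; apply: subsetIl.
have := card_cut h; have := card_cut h'; have := card_cut hu; have := card_cut hi.
have := cardsUI R R'; have := cardsUI (nb R :&: U) (nb R' :&: U).
have -> : (nb R :&: U) :|: (nb R' :&: U) = nb (R :|: R') :&: U by rewrite nbU setIUl.
have : #|nb (R :&: R') :&: U| <= #|(nb R :&: U) :&: (nb R' :&: U)|.
  apply: subset_leq_card; rewrite subsetI; apply/andP; split; apply: setSI; apply: nbS;
  [exact: subsetIl|exact: subsetIr].
lia.
Qed.

Definition feasible U W A R := [&& A \subset R, R \subset U & [disjoint R & W]].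

(** The size of a minimum vertex cut in [U] between [A] and [W], where the cut may use vertices of
    [W]. The default [A] is feasible as soon as some set is, by [feasible_refl]. *)
Definition lam U W A := #|cut U [arg min_(R < A | feasible U W A R) #|cut U R|]|.

Lemma feasible_refl U W A R : feasible U W A R -> feasible U W A A.
Proof.
move=> /and3P[h1 h2 h3]; rewrite /feasible subxx (subset_trans h1) //=.
by rewrite (disjointWl h1).
Qed.

Lemma lam_ex U W A : feasible U W A A ->
  exists2 R, feasible U W A R & lam U W A = #|cut U R|.
Proof. by rewrite /lam => hA; case: arg_minnP => // R h _; exists R. Qed.

Lemma lam_le U W A R : feasible U W A R -> lam U W A <= #|cut U R|.
Proof.
by move=> h; rewrite /lam; case: arg_minnP => [|R' _]; [exact: feasible_refl h|exact].
Qed.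

Lemma lam_mono U W A A' : A \subset A' -> feasible U W A' A' -> lam U W A <= lam U W A'.
Proof.
move=> hA /lam_ex[R /and3P[h1 h2 h3] ->]; apply: lam_le.
by rewrite /feasible (subset_trans hA) // h2.
Qed.

(** A minimizer for the smaller graph stays feasible in the larger one, and its boundary gains at
    most [v]. *)
Lemma lam_del U W A v : v \notin A -> feasible U W A A ->
  lam U W A <= (lam (U :\ v) (W :\ v) A).+1.
Proof.
move=> vA /and3P[_ h2 h3].
have /lam_ex[R /and3P[h4 h5 h6] ->] : feasible (U :\ v) (W :\ v) A A.
  rewrite /feasible subxx subsetD1 h2 vA /=.
  by apply: disjointWr h3; apply: subsetDl.
have hR : R \subset U by apply: subset_trans h5 (subsetDl _ _).
have vR : v \notin R by apply/negP => /(subsetP h5); rewrite !inE eqxx.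
apply: leq_trans (lam_le (R := R) _) _.
  rewrite /feasible h4 hR /=; move: h6; rewrite !disjoints_subset => /subsetP h6.
  apply/subsetP => x xR; have := h6 x xR; rewrite !inE negb_and negbK.
  by case/orP => // /eqP xv; rewrite -xv xR in vR.
have h : cut U R \subset v |: cut (U :\ v) R.
  by apply/subsetP => x; rewrite !inE => /and3P[-> -> ->]; rewrite !andbT; case: eqP.
by apply: leq_trans (subset_leq_card h) _; rewrite cardsU1; case: (_ \notin _).
Qed.

(* Pushing: once a minimizer above A is found, every feasible set may be
   enlarged to contain it without enlarging its cut. *)
Lemma push U W A R A' : A \subset A' -> feasible U W A' A' -> lam U W A' = lam U W A ->
  feasible U W A R ->
  exists R', [/\ R \subset R', feasible U W A' R' & #|cut U R'| <= #|cut U R|].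
Proof.
move=> hA hA' hl hR; have [S hS hlS] := lam_ex hA'.
case/and3P: hR => h1 h2 h3; case/and3P: hS => h4 h5 h6.
exists (R :|: S); split; first exact: subsetUl.
  rewrite /feasible (subset_trans h4) ?subsetUr // subUset h2 h5 /=.
  by move: h3 h6; rewrite !disjoints_subset subUset => -> ->.
have := cut_submod h2 h5.
have : lam U W A <= #|cut U (R :&: S)|.
  apply: lam_le; rewrite /feasible subsetI h1 (subset_trans hA) //=.
  by rewrite (subset_trans _ h2) ?subsetIl //= (disjointWl _ h3) // subsetIl.
lia.
Qed.

(** The last hypothesis says that at most [z] vertices of [U] are deleted. The sets [nb R :&: U] and
    [X :&: nb R'] are disjoint parts of [nb R' :&: U]; as the boundary does not grow, [X] loses no
    more vertices than [R] gains. *)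
Lemma closed_push U R R' X z : R \subset R' -> R \subset U -> R' \subset U ->
  #|cut U R'| <= #|cut U R| ->
  X \subset U -> [disjoint X & nb R] -> #|U| <= #|R| + #|X| + z ->
  #|U| <= #|R'| + #|X :\: nb R'| + z.
Proof.
move=> hRR hR hR' hcut hX hXR hz.
have h1 := card_cut hR; have h2 := card_cut hR'.
have h3 : #|nb R :&: U| + #|X :&: nb R'| <= #|nb R' :&: U|.
  have hd : [disjoint nb R :&: U & X :&: nb R'].
    rewrite disjoint_sym; apply: disjointWl (subsetIl _ _) _.
    by apply: disjointWr (subsetIl _ _) hXR.
  move: (leq_card_setU (nb R :&: U) (X :&: nb R')) => /leqifP.
  rewrite hd => /eqP <-; apply: subset_leq_card; rewrite subUset setSI ?nbS //=.
  by rewrite setIC setIS.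
have := cardsID (nb R') X; lia.
Qed.

Definition wants (M P : {set V}) := [set x in M | [exists y in P, adj x y]].

(* Koenig duality for the cut of R, with P the complement of nb R. *)
Lemma lam_deficiency U W A f : feasible U W A A -> W \subset U ->
  (forall P : {set V}, P \subset U :\: nb A -> #|P| <= f + #|wants (U :\: A :\: W) P|) ->
  (exists2 P : {set V}, P \subset U :\: nb A & f + #|wants (U :\: A :\: W) P| <= #|P|) ->
  f + lam U W A = #|W|.
Proof.
move=> hA hW hup [P hP hlow]; apply/eqP; rewrite eqn_leq; apply/andP; split.
  set Q := wants _ _ in hlow.
  have hQ : Q \subset U :\: W.
    by apply/subsetP => x; rewrite !inE => /andP[/and3P[-> _ ->]].
  (* Upper bound on [lam]: no vertex of this [R] has a closed out-neighbour in [P], so its boundary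
     is small. *)
  pose R := U :\: W :\: Q; case/and3P: (hA) => _ hAU hAW.
  have hRU : R \subset U by exact: subset_trans (subsetDl _ _) (subsetDl _ _).
  have hR : feasible U W A R.
    rewrite /feasible hRU; apply/andP; split.
      apply/subsetP => x xA; rewrite !inE xA (subsetP hAU) //= andbF /= andbT.
      by move: hAW; rewrite disjoints_subset => /subsetP /(_ x xA); rewrite inE.
    by rewrite disjoints_subset; apply/subsetP => x; rewrite !inE => /and3P[].
  have := lam_le hR; have := card_cut hRU.
  have hd : #|nb R :&: U| + #|P| <= #|U|.
    have hd : [disjoint nb R :&: U & P].
      rewrite disjoint_sym disjoints_subset; apply/subsetP => y yP; rewrite !inE negb_and.
      apply/orP; left; apply/negP => /existsP[x /andP[]]; rewrite !inE => /and3P[h1 h2 h3] hxy.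
      move: h1; rewrite h2 h3 !andbT /=; case: (boolP (x \in A)) => xA.
        have := subsetP hP y yP; rewrite !inE => /andP[/negP hyA _]; case: hyA.
        by apply/existsP; exists x; rewrite xA.
      by move=> /negP[]; apply/existsP; exists y; rewrite yP.
    move: (leq_card_setU (nb R :&: U) P) => /leqifP; rewrite hd => /eqP <-.
    apply: subset_leq_card; rewrite subUset subsetIr /=.
    by apply: subset_trans hP _; apply: subsetDl.
  have := cardsID Q (U :\: W); rewrite (setIidPr hQ) -/R.
  have := cardsID W U; rewrite (setIidPr hW); lia.
(* Lower bound: for an optimal [R], the bidders outside [nb R] want no vertex of [R]. *)
have [R hR ->] := lam_ex hA; case/and3P: hR => h1 h2 h3.
have hP' : U :\: nb R \subset U :\: nb A by apply: setDS; apply: nbS.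
have := hup _ hP'.
have : #|wants (U :\: A :\: W) (U :\: nb R)| <= #|U :\: W :\: R|.
  apply: subset_leq_card; apply/subsetP => x; rewrite !inE.
  move=> /andP[/and3P[-> _ ->] /existsP[y]]; rewrite !inE !andbT => /andP[/andP[hy _] hxy].
  by apply: contra hy => xR; apply/existsP; exists x; rewrite xR.
have := card_cut h2; have := cardsID (nb R) U; rewrite setIC.
have := cardsID W U; rewrite (setIidPr hW).
have := cardsID R (U :\: W); have -> : (U :\: W) :&: R = R.
  apply/setIidPr; rewrite subsetD h2 /=; exact: h3.
lia.
Qed.

(** * Balanced sets and sink components *)

Section Balanced.
Variables (T : {set V}) (r : nat).

Definition reach X := connect (del e (~: X)).
(** Here [X] is the set of kept vertices, the complement of the separator. *)
Definition bal X := balanced_separator e T r (~: X).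

Lemma balP X : reflect
  (forall x, x \in X -> #|[set y in X :&: T | reach X x y && reach X y x]| <= r) (bal X).
Proof.
have E x : [set y in X :&: T | reach X x y && reach X y x] =
   [set y in ~: ~: X | strongly_connected e (~: X) x y] :&: T.
  by apply/setP => y; rewrite !inE negbK /reach; do ?case: (y \in _); rewrite ?andbF ?andbT.
apply: (iffP forall_inP) => [h x xX|h C /imsetP[x xX ->]].
  by rewrite E; apply: h; apply/imsetP; exists x; rewrite ?setCK.
by rewrite -E; apply: h; rewrite setCK in xX.
Qed.

Lemma reachS X X' : X \subset X' -> subrel (reach X) (reach X').
Proof.
move=> /subsetP h; apply: connect_sub => x y /and3P[]; rewrite !inE !negbK => hx hy exy.
by apply: connect1; rewrite /del /= !inE !negbK !h.
Qed.

Lemma balS X X' : X \subset X' -> bal X' -> bal X.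
Proof.
move=> h /balP hb; apply/balP => x xX; apply: leq_trans (hb x (subsetP h _ xX)).
apply: subset_leq_card; apply/subsetP => y; rewrite !inE => /andP[/andP[yX ->] /andP[h1 h2]].
by rewrite (subsetP h _ yX) !(reachS h).
Qed.

Lemma bal_small X : #|X :&: T| <= r -> bal X.
Proof.
move=> h; apply/balP => x _; apply: leq_trans h; apply: subset_leq_card.
by apply/subsetP => y; rewrite inE => /andP[].
Qed.

(** No edge leads from [R] to [Q], so a strong component of the union lies in one of the two. *)
Lemma bal_split R Q : [disjoint nb R & Q] -> #|R :&: T| <= r -> bal Q -> bal (R :|: Q).
Proof.
move=> hd hR /balP hQ.
have stay x p : path (del e (~: (R :|: Q))) x p -> x \in R -> last x p \in R.
  elim: p x => //= z p IH x /andP[/and3P[_ hz exz] hp] xR; apply: IH hp _.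
  move: hz; rewrite !inE negbK => /orP[//|zQ].
  move: hd; rewrite disjoint_sym disjoints_subset => /subsetP /(_ z zQ).
  by rewrite !inE => /negP[]; apply/existsP; exists x; rewrite xR /adj exz orbT.
(* A walk that ends outside [R] never visits [R], since it could not leave it. *)
have stayQ x p : path (del e (~: (R :|: Q))) x p -> last x p \notin R ->
    path (del e (~: Q)) x p.
  elim: p x => //= z p IH x /andP[hxz hp] hl; rewrite (IH _ hp hl) andbT.
  have zR : z \notin R by apply: contra hl; apply: stay hp.
  have xR : x \notin R.
    by apply: contra zR => xR; apply: (stay x [:: z]); rewrite //= hxz.
  by case/and3P: hxz; rewrite /del /= !inE !negbK (negPf xR) (negPf zR) /= => -> -> ->.
apply/balP => x; rewrite inE; case: (boolP (x \in R)) => [xR _|xR /= xQ].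
  apply: leq_trans hR; apply: subset_leq_card; apply/subsetP => y.
  rewrite !inE => /andP[/andP[_ ->]] /andP[/connectP[p hp ->] _].
  by rewrite andbT; apply: stay hp xR.
apply: leq_trans (hQ x xQ); apply: subset_leq_card; apply/subsetP => y; rewrite !inE.
move=> /andP[/andP[hy ->]] /andP[/connectP[p hp hl] /connectP[p' hp' hl']].
have yR : y \notin R by apply: contra xR; rewrite hl'; apply: stay.
rewrite (negPf yR) /= in hy; rewrite hy /=; apply/andP; split; apply/connectP.
  by exists p => //; apply: stayQ; rewrite -?hl.
by exists p' => //; apply: stayQ; rewrite -?hl'.
Qed.

(** Take a terminal [t] whose reachable set is smallest. Every terminal reached from [t] has the
    same reachable set, hence reaches [t] back and lies in its strong component. *)
Lemma sink_class X : bal X -> X :&: T != set0 ->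
  exists R, [/\ R \subset X, R :&: T != set0, #|R :&: T| <= r & nb R :&: X \subset R].
Proof.
move=> /balP hb /set0Pn[t0 ht0].
pose S t := [set y in X | reach X t y].
have [t ht hmin] := @arg_minnP _ t0 (fun t => t \in X :&: T) (fun t => #|S t|) ht0.
have /andP[tX tT] : (t \in X) && (t \in T) by rewrite -in_setI.
exists (S t); split.
- by apply/subsetP => y; rewrite inE => /andP[].
- by apply/set0Pn; exists t; rewrite !inE tX tT /reach connect0.
- apply: leq_trans (hb t tX); apply: subset_leq_card; apply/subsetP => y.
  rewrite !inE => /andP[/andP[yX hty] yT]; rewrite yX yT hty /=.
  have hs : S y \subset S t.
    apply/subsetP => z; rewrite !inE => /andP[-> hyz] /=.
    exact: connect_trans hty hyz.
  have /eqP hS : S y == S t by rewrite eqEcard hs hmin // inE yX.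
  by have : t \in S y; [rewrite hS inE tX /reach connect0|rewrite inE => /andP[]].
apply/subsetP => y; rewrite !inE => /andP[/existsP[x]]; rewrite inE.
move=> /andP[/andP[xX htx]] /orP[/eqP <-|exy] yX; rewrite yX //=.
by apply: connect_trans htx _; apply: connect1; rewrite /del /= !inE !negbK xX yX.
Qed.

End Balanced.
End Separation.

(** * The branching search *)

(* [inside] is the known part A of the set R being built, [outside] the alive
   terminals not in A, and [capacity] the number of terminals A may still get.
   Vertices neither alive nor deleted belong to finished components. *)
Record state (V : Type) := State {
  alive : seq V; deleted : seq V; inside : seq V; outside : seq V;
  budget : nat; capacity : nat }.

Definition tuple_of_state V (st : state V) :=
  (alive st, deleted st, inside st, outside st, budget st, capacity st).

Definition state_of_tuple V (p : seq V * seq V * seq V * seq V * nat * nat) :=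
  let: (U, Z, A, W, s, c) := p in State U Z A W s c.

Lemma tuple_of_stateK V : cancel (@tuple_of_state V) (@state_of_tuple V).
Proof. by case. Qed.

HB.instance Definition _ (V : eqType) :=
  Equality.copy (state V) (can_type (@tuple_of_stateK V)).

Section Search.
Variables (V : finType) (e : rel V) (T : {set V}) (r : nat).
Implicit Types (x y t u v : V) (l A U W Z : seq V) (st : state V) (R X Y : {set V}).
Notation state := (state V).
Notation adj := (adj e).
Notation nb := (nb e).
Notation cut := (cut e).
Notation bal := (bal e T r).

Definition diff l l' := [seq x <- l | x \notin l'].
Definition nbr A y := has (fun x => adj x y) A.
Definition nbrs A l := [seq y <- l | nbr A y].
Definition listlam U W A := lam e [set:: U] [set:: W] [set:: A].

Fixpoint close U W A l :=
  if l is u :: l' then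
    close U W (if listlam U W (u :: A) <= listlam U W A then u :: A else A) l'
  else A.

Definition del_succ st v :=
  if budget st is s.+1 then
    [:: State (diff (alive st) [:: v]) (v :: deleted st) (inside st)
          (diff (outside st) [:: v]) s (capacity st)]
  else [::].

Definition mov_succ st t :=
  if capacity st is c.+1 then
    [:: State (alive st) (deleted st) (t :: inside st) (diff (outside st) [:: t])
          (budget st) c]
  else [::].

Fixpoint moves st l :=
  if l is t :: l' then mov_succ st t ++ (del_succ st t ++ moves st l') else [::].

(** A terminal enters [inside] only through [mov_succ], which pays for it from [capacity]. *)
Definition add_succ st v :=
  if v \in outside st then [::]
  else [:: State (alive st) (deleted st) (v :: inside st) (outside st)
             (budget st) (capacity st)].

(** An empty boundary means that [inside] is finished: its vertices cease to be alive without being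
    deleted, and the next component starts with full capacity [r]. *)
Definition branch st :=
  if nbrs (inside st) (diff (alive st) (inside st)) is v :: _ then
    del_succ st v ++ add_succ st v
  else [:: State (diff (alive st) (inside st)) (deleted st) [::] (outside st)
             (budget st) r].

Definition free st := diff (diff (alive st) (inside st)) (outside st).

Definition closed st :=
  State (alive st) (deleted st)
    (close (alive st) (outside st) (inside st) (free st))
    (outside st) (budget st) (capacity st).

(** Moving an outside terminal serves the terminals of the component still missing from [inside];
    deleting one serves solutions that keep no further terminal. *)
Definition step st := moves st (outside st) ++ branch (closed st).

Fixpoint search f st :=
  if outside st is [::] then Some (deleted st)
  else if f is f'.+1 then
    foldr (fun st' res => if search f' st' is Some z then Some z else res)
      None (step st)
  else None.

Definition init U (ts : seq V) s := State U [::] [::] ts s r.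

(** [s0] is the initial budget. In [inv_bal] the vertices neither alive nor deleted are those of
    finished components: keeping all of them next to a balanced set of alive vertices preserves
    balance. *)
Record inv s0 st : Prop := Inv {
  inv_Uu : uniq (alive st);
  inv_Zu : uniq (deleted st);
  inv_Au : uniq (inside st);
  inv_Wu : uniq (outside st);
  inv_AU : {subset inside st <= alive st};
  inv_WU : {subset outside st <= alive st};
  inv_AW : {in inside st, forall x, x \notin outside st};
  inv_ZU : {in deleted st, forall x, x \notin alive st};
  inv_WT : {subset outside st <= T};
  inv_TU : {in alive st, forall x, x \in T -> (x \in inside st) || (x \in outside st)};
  inv_cap : #|[set:: inside st] :&: T| + capacity st <= r;
  inv_size : size (deleted st) + budget st = s0;
  inv_bal : forall X, X \subset [set:: alive st] -> bal X ->
    bal (X :|: ~: ([set:: alive st] :|: [set:: deleted st])) }.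

Lemma mem_diff l l' x : (x \in diff l l') = (x \in l) && (x \notin l').
Proof. by rewrite mem_filter andbC. Qed.

Lemma diff_uniq l l' : uniq l -> uniq (diff l l').
Proof. exact: filter_uniq. Qed.

Lemma size_diff1 l v : uniq l -> size (diff l [:: v]) = size l - (v \in l).
Proof.
move=> h; have -> : diff l [:: v] = rem v l.
  by rewrite rem_filter //; apply: eq_filter => x; rewrite inE.
by case: (boolP (v \in l)) => hv; [rewrite size_rem // subn1|rewrite rem_id // subn0].
Qed.

Lemma set_diff l l' : [set:: diff l l'] = [set:: l] :\: [set:: l'].
Proof. by apply/setP => x; rewrite !inE mem_diff andbC. Qed.

Lemma set_diff1 l v : [set:: diff l [:: v]] = [set:: l] :\ v.
Proof. by rewrite set_diff; congr (_ :\: _); apply/setP => x; rewrite !inE. Qed.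

Lemma card_seq l : uniq l -> #|[set:: l]| = size l.
Proof. by move=> /card_uniqP <-; apply: eq_card => x; rewrite inE. Qed.

Lemma nbrE A y : nbr A y = (y \in nb [set:: A]).
Proof.
rewrite inE; apply/hasP/existsP => [[x xA h]|[x /andP[]]]; last by rewrite inE; exists x.
by exists x; rewrite inE xA.
Qed.

(** * Invariants and soundness of the search *)

Section Invariant.
Variables (s0 : nat).
Notation inv := (inv s0).

Lemma inv_free st : inv st -> [/\ uniq (inside st ++ free st),
  {subset inside st ++ free st <= alive st} &
  {in inside st ++ free st, forall x, x \notin outside st}].
Proof.
move=> hI; split.
- rewrite cat_uniq (inv_Au hI) !filter_uniq ?(inv_Uu hI) // andbT /=.
  by apply/hasPn => x; rewrite !mem_diff -andbA => /and3P[].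
- move=> x; rewrite mem_cat => /orP[/(inv_AU hI) //|].
  by rewrite !mem_diff -andbA => /and3P[].
move=> x; rewrite mem_cat => /orP[/(inv_AW hI) //|].
by rewrite !mem_diff -andbA => /and3P[].
Qed.

Lemma inv_del st st' v : inv st -> v \in alive st -> v \notin inside st ->
  st' \in del_succ st v -> inv st'.
Proof.
case: st => U Z A W s c [/= hU hZ hA hW hAU hWU hAW hZU hWT hTU hc hs hb] vU vA.
rewrite /del_succ /=; case: s hs => // s hs; rewrite inE => /eqP ->; split=> //=.
- exact: diff_uniq.
- by rewrite hZ andbT; apply: contraL vU; apply: hZU.
- exact: diff_uniq.
- by move=> x xA; rewrite mem_diff hAU //= inE; apply: contraNneq vA => <-.
- by move=> x; rewrite !mem_diff => /andP[/hWU -> ->].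
- by move=> x xA; rewrite mem_diff negb_and hAW.
- move=> x; rewrite inE => /predU1P[->|/hZU]; first by rewrite mem_diff inE eqxx andbF.
  by rewrite mem_diff negb_and => ->.
- by move=> x; rewrite mem_diff => /andP[/hWT].
- by move=> x; rewrite !mem_diff => /andP[/hTU h ->] /h; rewrite andbT.
- by rewrite -hs addnS.
move=> X hX /hb hX'.
have -> : [set:: diff U [:: v]] :|: [set:: v :: Z] = [set:: U] :|: [set:: Z].
  by apply/setP => x; rewrite !inE mem_diff inE; case: eqP => [->|]; rewrite ?vU ?andbT.
by apply: hX'; apply: subset_trans hX _; rewrite set_diff subsetDl.
Qed.

Lemma inv_mov st st' t : inv st -> t \in outside st -> st' \in mov_succ st t -> inv st'.
Proof.
case: st => U Z A W s c [/= hU hZ hA hW hAU hWU hAW hZU hWT hTU hc hs hb] tW.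
have tA : t \notin A by apply: contraL tW; apply: hAW.
rewrite /mov_succ /=; case: c hc => // c hc; rewrite inE => /eqP ->; split=> //=.
- by rewrite tA.
- exact: diff_uniq.
- by move=> x; rewrite inE => /predU1P[->|/hAU //]; apply: hWU.
- by move=> x; rewrite mem_diff => /andP[/hWU].
- move=> x; rewrite inE mem_diff inE negb_and negbK => /predU1P[->|/hAW ->] //.
  by rewrite eqxx orbT.
- by move=> x; rewrite mem_diff => /andP[/hWT].
- move=> x xU xT; rewrite inE mem_diff inE; case: eqP => //= _; rewrite andbT.
  exact: hTU.
apply: leq_trans hc; rewrite addnS -addSn leq_add2r.
rewrite set_cons setIUl; apply: leq_trans (leq_card_setU _ _) _.
rewrite -addn1 addnC leq_add2l; apply: leq_trans (subset_leq_card (subsetIl _ _)) _.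
by rewrite cards1.
Qed.

Lemma inv_add st st' v : inv st -> v \in alive st -> v \notin inside st ->
  st' \in add_succ st v -> inv st'.
Proof.
case: st => U Z A W s c [/= hU hZ hA hW hAU hWU hAW hZU hWT hTU hc hs hb] vU vA.
rewrite /add_succ /=; case: ifPn => // vW; rewrite inE => /eqP ->; split=> //=.
- by rewrite vA.
- by move=> x; rewrite inE => /predU1P[->|/hAU].
- by move=> x; rewrite inE => /predU1P[->|/hAW].
- by move=> x xU xT; rewrite inE -orbA hTU ?orbT.
suff -> : [set:: v :: A] :&: T = [set:: A] :&: T by [].
apply/setP => x; rewrite !inE; case: eqP => [->|//]; case: (boolP (v \in T)) => vT.
  by move: (hTU v vU vT); rewrite (negPf vA) (negPf vW).
by rewrite !andbF.
Qed.

(** The finished set has no edge to the other alive vertices and at most [r] terminals, so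
    [bal_split] lets it be kept. *)
Lemma inv_finish st : inv st -> nbrs (inside st) (diff (alive st) (inside st)) = [::] ->
  inv (State (diff (alive st) (inside st)) (deleted st) [::] (outside st) (budget st) r).
Proof.
case: st => U Z A W s c [/= hU hZ hA hW hAU hWU hAW hZU hWT hTU hc hs hb] hn.
split=> //=.
- exact: diff_uniq.
- move=> x xW; rewrite mem_diff hWU //=; apply: contraL xW; exact: hAW.
- by move=> x /hZU; rewrite mem_diff negb_and => ->.
- by move=> x; rewrite mem_diff => /andP[xU xA] /(hTU _ xU); rewrite (negPf xA).
- have -> : [set:: [::]] :&: T = set0 by apply/setP => x; rewrite !inE.
  by rewrite cards0.
move=> X hX hbX.
have -> : X :|: ~: ([set:: diff U A] :|: [set:: Z]) =
    ([set:: A] :|: X) :|: ~: ([set:: U] :|: [set:: Z]).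
  apply/setP => x; rewrite !inE mem_diff; case: (boolP (x \in A)) => xA /=.
    by rewrite andbF /=; case: (boolP (x \in Z)) => [/hZU|]; rewrite ?orbT // hAU.
  by rewrite andbT.
apply: hb.
  apply/subsetP => x; rewrite !inE => /orP[/hAU //|/(subsetP hX)].
  by rewrite inE mem_diff => /andP[].
apply: bal_split => //; last by apply: leq_trans hc; apply: leq_addr.
rewrite disjoint_sym disjoints_subset; apply/subsetP => x xX; rewrite inE.
apply/negP; rewrite -nbrE => xn.
have : x \in nbrs A (diff U A) by rewrite mem_filter xn; have := subsetP hX x xX; rewrite inE.
by rewrite hn.
Qed.

Lemma close_sub U W A l : {subset A <= close U W A l}.
Proof.
elim: l A => [|u l IH] A x xA //=; case: ifP => _; apply: IH => //.
by rewrite inE xA orbT.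
Qed.

Lemma close_mem U W A l x : x \in close U W A l -> (x \in A) || (x \in l).
Proof.
elim: l A => [|u l IH] A /=; first by rewrite orbF.
by case: ifP => _ /IH; rewrite !inE; case: (x == u); case: (x \in A); case: (x \in l).
Qed.

Lemma close_uniq U W A l : uniq (A ++ l) -> uniq (close U W A l).
Proof.
elim: l A => [|u l IH] A /=; first by rewrite cats0.
rewrite (perm_uniq (permEl (perm_catCA A [:: u] l))) /= => /andP[h1 h2].
by case: ifP => _; apply: IH; rewrite //= h1.
Qed.

Lemma inv_closed st : inv st -> inv (closed st).
Proof.
move=> hI; have [hfree _ _] := inv_free hI.
case: st hI hfree => U Z A W s c [/= hU hZ hA hW hAU hWU hAW hZU hWT hTU hc hs hb] hfree.
rewrite /closed /free /=; set A' := close _ _ _ _.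
have hmem x : x \in A' -> (x \in A) \/ [/\ x \in U, x \notin A & x \notin W].
  by move=> /close_mem /orP[]; [left|rewrite !mem_diff -andbA => /and3P[]; right].
split=> //=.
- by apply: close_uniq.
- by move=> x /hmem[/hAU|[]].
- by move=> x /hmem[/hAW|[]].
- by move=> x xU xT; case/orP: (hTU x xU xT) => [/close_sub ->|->] //; rewrite orbT.
suff -> : [set:: A'] :&: T = [set:: A] :&: T by [].
apply/setP => x; rewrite !inE; apply/andP/andP => [[h xT]|[xA xT]]; last first.
  by split=> //; apply: close_sub.
split=> //; case/hmem: h => // -[xU xA xW].
by move: (hTU x xU xT); rewrite (negPf xA) (negPf xW).
Qed.

Lemma moves_mem st st' l : st' \in moves st l ->
  exists2 t, t \in l & (st' \in mov_succ st t) || (st' \in del_succ st t).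
Proof.
elim: l => //= t l IH; rewrite !mem_cat => /or3P[h|h|/IH[t' h1 h2]].
- by exists t; rewrite ?inE ?eqxx // h.
- by exists t; rewrite ?inE ?eqxx // h orbT.
by exists t' => //; rewrite inE h1 orbT.
Qed.

Lemma nbrs_head A U v vs : nbrs A (diff U A) = v :: vs ->
  [/\ v \in U, v \notin A & v \in nb [set:: A]].
Proof.
move=> h; have : v \in nbrs A (diff U A) by rewrite h mem_head.
by rewrite mem_filter mem_diff nbrE => /and3P[].
Qed.

Lemma inv_branch st st' : inv st -> st' \in branch st -> inv st'.
Proof.
move=> hI; rewrite /branch; case E: nbrs => [|v vs].
  by rewrite inE => /eqP ->; apply: inv_finish.
have [vU vA _] := nbrs_head E.
by rewrite mem_cat => /orP[]; [apply: inv_del|apply: inv_add].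
Qed.

Lemma inv_step st st' : inv st -> st' \in step st -> inv st'.
Proof.
move=> hI; rewrite mem_cat => /orP[/moves_mem[t tW] /orP[]|].
- exact: inv_mov.
- by apply: inv_del => //; [apply: inv_WU hI _ tW|apply: contraL tW; apply: inv_AW hI _].
by apply: inv_branch; apply: inv_closed.
Qed.

(** When no terminal is outside, all alive terminals are inside, at most [r] in number by [inv_cap].
    The whole alive set is then balanced, and [inv_bal] adds the finished vertices. *)
Lemma search_sound f st z : inv st -> search f st = Some z ->
  [/\ uniq z, size z <= s0 & balanced_separator e T r [set:: z]].
Proof.
have base st' : inv st' -> outside st' = [::] ->
    [/\ uniq (deleted st'), size (deleted st') <= s0
      & balanced_separator e T r [set:: deleted st']].
  move=> hI hW; split; first exact: inv_Zu hI.
    by rewrite -(inv_size hI) leq_addr.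
  rewrite -[[set:: _]]setCK; have := inv_bal hI (subxx _).
  suff -> : [set:: alive st'] :|: ~: ([set:: alive st'] :|: [set:: deleted st'])
      = ~: [set:: deleted st'].
    apply; apply: bal_small; apply: leq_trans (leq_trans (leq_addr _ _) (inv_cap hI)).
    apply: subset_leq_card; apply/subsetP => x; rewrite !inE => /andP[xU xT].
    by have := inv_TU hI xU xT; rewrite hW orbF => ->.
  apply/setP => x; rewrite !inE; case: (boolP (x \in deleted st')) => [/(inv_ZU hI) /negPf ->|_].
    by rewrite orbT.
  by rewrite orbF orbN.
elim: f st z => [|f IH] st z hI /=; case E: (outside st) => [|w ws] //.
- by case=> <-; apply: base.
- by case=> <-; apply: base.
have {E}: {subset step st <= step st} by [].
elim: {1 3}(step st) => //= st' l IHl hs.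
case E: (search f st') => [z'|].
  by case=> <-; apply: IH E; apply: inv_step hI _; apply: hs; rewrite mem_head.
by apply: IHl => x xl; apply: hs; rewrite inE xl orbT.
Qed.

End Invariant.
End Search.

(** * Completeness of the search *)

Ltac nlia :=
  repeat match goal with h : ?P |- _ =>
    lazymatch P with
    | is_true (leq _ _) => fail
    | @eq nat _ _ => fail
    | _ => clear h
    end end;
  repeat match goal with
  | h : is_true (leq _ _) |- _ => revert h
  | h : @eq nat _ _ |- _ => revert h
  end;
  repeat match goal with
  | |- context [size ?l] => generalize (size l)
  | |- context [lam ?e ?U ?W ?A] => generalize (lam e U W A)
  | |- context [listlam ?e ?U ?W ?A] => generalize (listlam e U W A)
  | |- context [card ?P] => generalize (card P)
  end; lia.

Section Complete.
Variables (V : finType) (e : rel V) (T : {set V}) (r : nat).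
Implicit Types (x y t u v : V) (l A U W Z : seq V) (st : state V) (R X Y : {set V}).
Notation state := (state V).
Notation nb := (nb e).
Notation cut := (cut e).
Notation bal := (bal e T r).
Notation search := (search e r).
Notation inv := (inv e T r).

Lemma feasible_seq U W A : {subset A <= U} -> {in A, forall x, x \notin W} ->
  feasible [set:: U] [set:: W] [set:: A] [set:: A].
Proof.
move=> hU hW; rewrite /feasible subxx /=; apply/andP; split.
  by apply/subsetP => x; rewrite !inE; apply: hU.
by rewrite disjoints_subset; apply/subsetP => x; rewrite !inE; apply: hW.
Qed.

Lemma listlam_mono U W A A' : {subset A <= A'} -> {subset A' <= U} ->
  {in A', forall x, x \notin W} -> listlam e U W A <= listlam e U W A'.
Proof.
move=> h hU hW; apply: lam_mono; last exact: feasible_seq.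
by apply/subsetP => x; rewrite !inE; apply: h.
Qed.

(** A vertex refused at some stage made [lam] grow there; by monotonicity it still does so when
    added to the final, larger set. *)
Lemma close_lam U W A l : {subset A ++ l <= U} -> {in A ++ l, forall x, x \notin W} ->
  listlam e U W (close e U W A l) = listlam e U W A /\
  {in l, forall u, u \notin close e U W A l ->
    listlam e U W A < listlam e U W (u :: close e U W A l)}.
Proof.
elim: l A => [|u l IH] A hU hW //=.
set A1 := if _ then _ else _.
have hA1 : {subset A1 ++ l <= A ++ u :: l}.
  move=> x; rewrite /A1 !mem_cat inE; case: ifP => _; rewrite ?inE.
    by case: (x == u); rewrite ?orbT.
  by case/orP => ->; rewrite ?orbT.
have [||IH1 IH2] := IH A1.
- by move=> x /hA1; apply: hU.
- by move=> x /hA1; apply: hW.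
have hsub x : x \in close e U W A1 l -> x \in A ++ u :: l.
  by move=> /close_mem h; apply: hA1; rewrite mem_cat.
have hl : listlam e U W A1 = listlam e U W A.
  rewrite /A1; case: ifP => // h; apply/eqP; rewrite eqn_leq h /=.
  have huA x : x \in u :: A -> x \in A ++ u :: l.
    by rewrite mem_cat !inE; case: (x == u); case: (x \in A).
  apply: listlam_mono => [x xA|x /huA /hU //|x /huA /hW //].
  by rewrite inE xA orbT.
split; first by rewrite IH1.
move=> x; rewrite inE => /predU1P[->{x}|xl] hx; last by rewrite -hl; apply: IH2.
have hn : (listlam e U W (u :: A) <= listlam e U W A) = false.
  apply/negbTE/negP => h; move: hx; rewrite /A1 h => /negP[]; apply: close_sub.
  by rewrite mem_head.
move/negbT: hn; rewrite -ltnNge => /leq_trans; apply.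
have hu x : x \in u :: close e U W A1 l -> x \in A ++ u :: l.
  by rewrite inE => /predU1P[->|/hsub //]; rewrite mem_cat mem_head orbT.
apply: listlam_mono => [x|x /hu /hU //|x /hu /hW //].
rewrite !inE => /predU1P[->|xA]; first by rewrite eqxx.
by apply/orP; right; apply: close_sub; rewrite /A1; case: ifP => // _; rewrite inE xA orbT.
Qed.

Lemma search_succ f st st' : outside st != [::] -> st' \in step e r st ->
  search f st' -> search f.+1 st.
Proof.
move=> hW hst hs; rewrite /=; case: (outside st) hW => // w ws _.
elim: (step e r st) hst => //= st1 l IH; rewrite inE => /predU1P[<-|/IH h].
  by case: (search f st') hs.
by case: (search f st1).
Qed.

Lemma search_nil f st : outside st = [::] -> search f st.
Proof. by case: f => [|f] /= ->. Qed.

(* In [fresh] and [growing], z bounds the number of deletions of a solution and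
   f is a fuel with which the search is bound to succeed. *)
Definition fresh st z f := [/\ inside st = [::], capacity st = r,
  2 * z + 3 * size (outside st) <= f &
  exists2 X : {set V}, X \subset [set:: alive st] & bal X /\ size (alive st) <= #|X| + z].

(* The solution keeps R and X and deletes the other alive vertices; terminals of
   R that are still outside have to be moved inside first. *)
Definition growing st z f := exists R X : {set V},
  [/\ feasible [set:: alive st] set0 [set:: inside st] R,
      X \subset [set:: alive st] /\ [disjoint X & nb R], bal X,
      size (alive st) <= #|R| + #|X| + z &
      #|R :&: [set:: outside st]| <= capacity st /\
      if R :&: [set:: outside st] == set0 then
        2 * z + 3 * size (outside st) + 1
          <= f + listlam e (alive st) (outside st) (inside st)
      else 2 * z + 3 * size (outside st) <= f].

Variable s0 : nat.
Notation inv0 := (inv s0).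

Lemma moves_mov st t l st' : t \in l -> st' \in mov_succ st t -> st' \in moves st l.
Proof.
move=> + h; elim: l => //= u l IH; rewrite inE !mem_cat => /predU1P[<-|/IH ->].
  by rewrite h.
by rewrite !orbT.
Qed.

Lemma moves_del st t l st' : t \in l -> st' \in del_succ st t -> st' \in moves st l.
Proof.
move=> + h; elim: l => //= u l IH; rewrite inE !mem_cat => /predU1P[<-|/IH ->].
  by rewrite h orbT.
by rewrite !orbT.
Qed.

(** The potential is [2 * z + 3 * size (outside st) - lam]. A move shrinks [outside], an addition
    raises [lam], and a deletion lowers [z] by 1 and [lam] by at most 1. Finishing a component
    happens at [lam = 0], where the [+ 1] in [growing] pays for the step. *)
Lemma search_growing f st z :
  (forall st z, inv0 st -> z <= budget st ->
     fresh st z f \/ growing st z f -> search f st) ->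
  inv0 st -> z <= budget st -> growing st z f.+1 -> search f.+1 st.
Proof.
move=> IH hI hz [R [X [hR [hXU hXR] hbX hsz [hcap hm]]]].
have [W0|W0] := eqVneq (outside st) [::]; first exact: search_nil.
have [AR RU _] := and3P hR.
move: hm; case: ifPn => hRW hm; last first.
  case/set0Pn: hRW => t; rewrite !inE => /andP[tR tW].
  have ht : t \in R :&: [set:: outside st] by rewrite !inE tR.
  have hc0 : 0 < capacity st by apply: leq_trans hcap; apply/card_gt0P; exists t.
  pose st' := State (alive st) (deleted st) (t :: inside st) (diff (outside st) [:: t])
     (budget st) (capacity st).-1.
  have hst : st' \in mov_succ st t
    by rewrite /mov_succ; case: (capacity st) hc0 @st' => //= c _; rewrite inE.
  apply: (search_succ W0 (st' := st')); first by rewrite mem_cat (moves_mov tW).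
  apply: (IH _ z) => //; first exact: inv_mov hst.
  right; exists R, X; rewrite /=.
  have hsW : size (diff (outside st) [:: t]) = (size (outside st)).-1.
    by rewrite size_diff1 ?(inv_Wu hI) // tW subn1.
  have hsW0 : 0 < size (outside st) by rewrite lt0n size_eq0.
  split=> //.
    rewrite /feasible RU disjoint_sym disjoints_subset sub0set !andbT /=.
    by apply/subsetP => x; rewrite !inE => /predU1P[-> //|xA]; apply: (subsetP AR); rewrite inE.
  have -> : R :&: [set:: diff (outside st) [:: t]] = (R :&: [set:: outside st]) :\ t.
    by rewrite set_diff1 setIDA.
  split; first by move: hcap; rewrite (cardsD1 t) ht; nlia.
  by rewrite hsW; case: ifP => _; nlia.
have RW : [disjoint R & [set:: outside st]] by rewrite -setI_eq0.
have hF : feasible [set:: alive st] [set:: outside st] [set:: inside st] R.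
  by rewrite /feasible AR RU.
have hI' := inv_closed hI.
pose A' := close e (alive st) (outside st) (inside st) (free st).
have [_ hfU hfW] := inv_free hI.
have [hlA hlu] := close_lam hfU hfW.
rewrite -/A' in hlA hlu.
have hFA : feasible [set:: alive st] [set:: outside st] [set:: A'] [set:: A'].
  by apply: feasible_seq; [exact: inv_AU hI'|exact: inv_AW hI'].
have hAA : [set:: inside st] \subset [set:: A'].
  by apply/subsetP => x; rewrite !inE; apply: close_sub.
(* The solution is changed so that its component contains the closure [A']; the rest [X] gives up
   [nb R'], at no total loss by [closed_push]. *)
have [R' [RR' hFR' hcut]] := push hAA hFA hlA hF.
have [AR' RU' RW'] := and3P hFR'.
have hsU : size (alive st) = #|[set:: alive st]| by rewrite card_seq // (inv_Uu hI).
pose X' := X :\: nb R'.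
have hsz' : size (alive st) <= #|R'| + #|X'| + z.
  by rewrite hsU; apply: closed_push (RU) _ _ _ _ _ => //; rewrite -?hsU.
have hX'U : X' \subset [set:: alive st] by apply: subset_trans hXU; apply: subsetDl.
have hX'R : [disjoint X' & nb R'].
  by rewrite disjoints_subset; apply/subsetP => x; rewrite !inE => /andP[].
have hbX' : bal X' by apply: balS hbX; apply: subsetDl.
have hst' st' : st' \in branch e r (closed e st) -> search f st' -> search f.+1 st.
  by move=> h; apply: search_succ W0 _; rewrite mem_cat h orbT.
case E: (nbrs e A' (diff (alive st) A')) => [|v vs].
  apply: (hst' (State (diff (alive st) A') (deleted st) [::] (outside st) (budget st) r)).
    by rewrite /branch /= -/A' E inE.
  apply: (IH _ z) => //; first exact: (inv_finish hI' E).
  have hnb : nb [set:: A'] :&: [set:: alive st] \subset [set:: A'].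
    apply/subsetP => x; rewrite in_setI -nbrE => /andP[h1]; rewrite !inE => xU.
    apply: contraT => xA; have : x \in nbrs e A' (diff (alive st) A').
      by rewrite mem_filter h1 mem_diff xU.
    by rewrite E.
  have hl0 : listlam e (alive st) (outside st) (inside st) = 0.
    apply/eqP; rewrite -hlA -leqn0; apply: leq_trans (lam_le e hFA) _.
    by rewrite leqn0 cards_eq0 /cut setD_eq0.
  left; split=> //=; first by move: hm; rewrite hl0; nlia.
  (* What [R'] has beyond [A'] contains no terminal, so it can be kept along with [X']. *)
  exists ((R' :\: [set:: A']) :|: X').
    rewrite set_diff subUset setSD //=; apply/subsetP => x xX; rewrite inE (subsetP hX'U) // andbT.
    apply: contraTN (xX) => xA; rewrite inE negb_and negbK; apply/orP; left.
    by apply: (subsetP (sub_nb e R')); apply: (subsetP AR').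
  split.
    apply: bal_split => //.
      rewrite disjoint_sym; apply: disjointWr hX'R; apply: nbS; apply: subsetDl.
    rewrite [_ :&: T](_ : _ = set0) ?cards0 //; apply/setP => x; rewrite !inE.
    apply/negbTE/negP => /andP[/andP[xA xR] xT].
    have xU := subsetP RU' x xR; rewrite inE in xU.
    have := inv_TU hI xU xT; case/orP => h.
      by move: xA; rewrite close_sub.
    by move: RW'; rewrite disjoints_subset => /subsetP /(_ x xR); rewrite !inE h.
  have hRX : [disjoint R' :\: [set:: A'] & X'].
    rewrite disjoint_sym; apply: disjointWr hX'R.
    by apply: subset_trans (sub_nb e R'); apply: subsetDl.
  rewrite cardsU (disjoint_setI0 hRX) cards0 subn0.
  rewrite -card_seq ?diff_uniq ?(inv_Uu hI) // set_diff.
  have := cardsID [set:: A'] R'; rewrite (setIidPr AR').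
  have := cardsID [set:: A'] [set:: alive st]; rewrite -hsU (setIidPr _); first nlia.
  by case/and3P: hFA.
have [vU vA vn] := nbrs_head E.
have [vR'|vR'] := boolP (v \in R').
  have vW : v \notin outside st.
    by move: RW'; rewrite disjoints_subset => /subsetP /(_ v vR'); rewrite !inE.
  pose st' := State (alive st) (deleted st) (v :: A') (outside st) (budget st) (capacity st).
  have hadd : st' \in add_succ (closed e st) v by rewrite /add_succ /= (negPf vW) inE.
  apply: (hst' st'); first by rewrite /branch /= -/A' E mem_cat hadd orbT.
  apply: (IH _ z) => //; first exact: inv_add hadd.
  right; exists R', X'; split=> //=.
    rewrite /feasible RU' disjoint_sym disjoints_subset sub0set !andbT /=.
    by apply/subsetP => x; rewrite !inE => /predU1P[-> //|xA]; apply: (subsetP AR'); rewrite inE.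
  rewrite (disjoint_setI0 RW') cards0 eqxx; split=> //.
  have vF : v \in free st.
    by rewrite !mem_diff vU vW andbT /=; apply: contra vA; apply: close_sub.
  by have := hlu v vF vA; rewrite -hlA in hm; move: hm; nlia.
(* The vertex [v] lies in [nb R'] but not in [R'], hence not in [X'] either: the solution deletes
   it. *)
pose st' := State (diff (alive st) [:: v]) (v :: deleted st) A' (diff (outside st) [:: v])
  (budget st).-1 (capacity st).
have vX' : v \notin X' by rewrite inE negb_and negbK (subsetP (nbS e AR')).
have hR'v : R' \subset [set:: alive st] :\ v by rewrite subsetD1 RU'.
have hX'v : X' \subset [set:: alive st] :\ v by rewrite subsetD1 hX'U.
have hsv : size (alive st) = #|[set:: alive st] :\ v|.+1 by rewrite hsU (cardsD1 v) inE vU.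
have hRX : #|R'| + #|X'| <= #|[set:: alive st] :\ v|.
  have hRX : [disjoint R' & X'].
    by rewrite disjoint_sym; apply: disjointWr hX'R; apply: sub_nb.
  have : R' :|: X' \subset [set:: alive st] :\ v by rewrite subUset hR'v.
  by move=> /subset_leq_card; rewrite cardsU (disjoint_setI0 hRX) cards0 subn0.
have z0 : 0 < z by nlia.
have hdel : st' \in del_succ (closed e st) v.
  by rewrite /del_succ /= /st'; case: (budget st) hz => [|s _]; [nlia|rewrite inE].
apply: (hst' st'); first by rewrite /branch /= -/A' E mem_cat hdel.
apply: (IH _ z.-1); [exact: inv_del hdel|rewrite /=; nlia|right].
exists R', X'; split=> //=.
- rewrite /feasible AR' set_diff1 hR'v disjoint_sym disjoints_subset sub0set //.
- by rewrite set_diff1.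
- by rewrite -card_seq ?diff_uniq ?(inv_Uu hI) // set_diff1; nlia.
have -> : R' :&: [set:: diff (outside st) [:: v]] = set0.
  apply/eqP; rewrite setI_eq0 set_diff1; apply: disjointWr RW'; apply: subsetDl.
rewrite cards0 eqxx; split=> //.
have : listlam e (alive st) (outside st) A' <=
    (listlam e (diff (alive st) [:: v]) (diff (outside st) [:: v]) A').+1.
  by rewrite /listlam !set_diff1; apply: lam_del; rewrite ?inE.
have : size (diff (outside st) [:: v]) <= size (outside st).
  by rewrite size_diff1 ?(inv_Wu hI) // leq_subr.
rewrite hlA; move: hm z0; set a := size _; set b := listlam _ _ _ _.
set c := size _; set d := listlam _ _ _ _; move: a b c d.
by clear; move=> a b c d; lia.
Qed.

(** If the solution keeps a terminal, a sink component is chosen as the set to grow; otherwise any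
    outside terminal can be deleted. *)
Lemma search_fresh f st z :
  (forall st z, inv0 st -> z <= budget st ->
     fresh st z f.-1 \/ growing st z f.-1 -> search f.-1 st) ->
  (growing st z f -> search f st) ->
  inv0 st -> z <= budget st -> fresh st z f -> search f st.
Proof.
move=> IH hG hI hz [hA hc hf [X hXU [hbX hsz]]].
have [W0|W0] := eqVneq (outside st) [::]; first exact: search_nil.
have hsW0 : 0 < size (outside st) by rewrite lt0n size_eq0.
have [XT|XT] := eqVneq (X :&: T) set0.
  case EW: (outside st) W0 => [//|t W'] W0.
  have tW : t \in outside st by rewrite EW mem_head.
  have tU := inv_WU hI tW; have tT := inv_WT hI tW.
  have tX : t \notin X.
    by apply/negP => tX; have : t \in X :&: T; [rewrite inE tX|rewrite XT inE].
  have hXt : X \subset [set:: alive st] :\ t by rewrite subsetD1 hXU.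
  have hst : size (alive st) = #|[set:: alive st] :\ t|.+1.
    by rewrite -card_seq ?(inv_Uu hI) // (cardsD1 t) inE tU.
  have z0 : 0 < z by have := subset_leq_card hXt; nlia.
  pose st' := State (diff (alive st) [:: t]) (t :: deleted st) (inside st)
    (diff (outside st) [:: t]) (budget st).-1 (capacity st).
  have hdel : st' \in del_succ st t.
    by rewrite /del_succ /= /st'; case: (budget st) hz => [|s _]; [nlia|rewrite inE].
  have tA : t \notin inside st by rewrite hA.
  have -> : f = f.-1.+1 by nlia.
  apply: (search_succ (st' := st')); rewrite ?EW //.
    by rewrite mem_cat (moves_del tW).
  apply: (IH _ z.-1); [exact: inv_del hdel|rewrite /=; nlia|left; split=> //=].
    by rewrite size_diff1 ?(inv_Wu hI) // tW; nlia.
  exists X; first by rewrite /= set_diff1.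
  split=> //=.
  by rewrite -card_seq ?diff_uniq ?(inv_Uu hI) // set_diff1; nlia.
(* Choosing the component makes no search step, so the fuel stays [f]. *)
apply: hG; have [R [RX hRT hRr hnb]] := sink_class hbX XT.
have hRW : R :&: [set:: outside st] = R :&: T.
  apply/setP => x; rewrite !inE; apply: andb_id2l => xR.
  apply/idP/idP => [/(inv_WT hI) //|xT].
  have xU := subsetP hXU x (subsetP RX x xR); rewrite inE in xU.
  by have := inv_TU hI xU xT; rewrite hA.
exists R, (X :\: R); rewrite hRW hc (negPf hRT); split=> //.
- rewrite /feasible hA (subset_trans RX) // disjoint_sym disjoints_subset sub0set !andbT /=.
  by apply/subsetP => x; rewrite !inE.
- split; first by apply: subset_trans hXU; apply: subsetDl.
  rewrite disjoints_subset; apply/subsetP => x; rewrite in_setC in_setD => /andP[xR xX].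
  by apply: contra xR => xn; apply: (subsetP hnb); rewrite in_setI xn.
- by apply: balS hbX; apply: subsetDl.
by have := cardsID R X; rewrite (setIidPr RX); nlia.
Qed.

Lemma search_complete f st z : inv0 st -> z <= budget st ->
  fresh st z f \/ growing st z f -> search f st.
Proof.
elim: f st z => [|f IH] st z hI hz h.
  have W0 : outside st = [::].
    case: h => [[_ _ h _]|[R [X [hR [hXU hXR] _ hsz [_ h]]]]]; apply: size0nil; first nlia.
    move: h; case: ifP => [/eqP RW0 h|_ h]; last nlia.
    have hRU : R \subset [set:: alive st] by case/and3P: hR.
    have hF : feasible [set:: alive st] [set:: outside st] [set:: inside st] R.
      by case/and3P: hR => h1 h2 _; rewrite /feasible h1 h2 -setI_eq0 RW0 eqxx.
    (* Without fuel, [growing] would demand [2 * z < lam], whereas the boundary of [R] is deleted by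
       the solution, so that [lam <= z]. *)
    have := lam_le e hF; have := card_cut e hRU.
    have : #|nb R :&: [set:: alive st]| + #|X| <= size (alive st).
      have hd : [disjoint nb R :&: [set:: alive st] & X].
        by rewrite disjoint_sym; apply: disjointWr hXR; apply: subsetIl.
      rewrite -card_seq ?(inv_Uu hI) //.
      have : (nb R :&: [set:: alive st]) :|: X \subset [set:: alive st].
        by rewrite subUset subsetIr.
      by move=> /subset_leq_card; rewrite cardsU (disjoint_setI0 hd) cards0 subn0.
    by move: h; rewrite /listlam; nlia.
  exact: search_nil.
have hG : growing st z f.+1 -> search f.+1 st by apply: search_growing hI hz.
by case: h => // h; apply: search_fresh hI hz h.
Qed.

End Complete.

(** * The initial state *)

Section Initial.
Variables (V : finType) (e : rel V) (T : {set V}) (r s : nat) (U ts : seq V).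
Hypotheses (Uu : uniq U) (memU : forall x, x \in U) (tsu : uniq ts) (memts : ts =i T).

Lemma inv_init : inv e T r s (init r U ts s).
Proof.
split=> //=.
- by move=> x; rewrite memts.
- by move=> x _; rewrite memts.
- have -> : [set:: [::]] :&: T = set0 by apply/setP => x; rewrite !inE.
  by rewrite cards0.
move=> X _; congr (balanced_separator _ _ _ (~: _)).
by apply/setP => x; rewrite !inE memU orbF.
Qed.

(** Initially [z] and the number of outside terminals are at most [size ts], so
    [2 * z + 3 * size ts] is at most [5 * size ts]. *)
Lemma search_init f (Y : {set V}) : 5 * size ts <= f ->
  balanced_separator e T r Y -> #|Y| <= s -> search e r f (init r U ts s).
Proof.
move=> hf hY hs; have hT : #|T| = size ts.
  by rewrite -card_seq //; apply: eq_card => x; rewrite inE memts.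
(* A separator larger than [T] is replaced by [T] itself, which leaves no terminal. *)
have [Y' [h1 h2 h3]] : exists Y' : {set V},
    [/\ bal e T r (~: Y'), #|Y'| <= s & #|Y'| <= size ts].
  have [h|h] := leqP #|Y| (size ts); first by exists Y; rewrite /bal setCK.
  exists T; rewrite hT leqnn (leq_trans (ltnW h) hs); split=> //.
  by apply: bal_small; rewrite setIC setICr cards0.
apply: (search_complete inv_init (z := #|Y'|)) => //; left; split=> //=; first nlia.
exists (~: Y'); first by apply/subsetP => x _; rewrite inE.
by split=> //; rewrite addnC cardsC -card_seq // max_card.
Qed.

End Initial.

(** * The program *)

Local Notation v0 := (EVar 0).
Local Notation v1 := (EVar 1).
Local Notation v2 := (EVar 2).
Local Notation v3 := (EVar 3).
Local Notation v4 := (EVar 4).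
Local Notation v5 := (EVar 5).
Local Notation "<| a , .. , b , c |>" := (ENode a .. (ENode b c) ..)
  (at level 0, a at level 99, b at level 99, c at level 99).

Definition efst a := ECase a ELeaf v0.
Definition esnd a := ECase a ELeaf v1.
(** Tuples nest to the right without terminator: the last component is a [rest], the earlier ones
    are [field]s. In the bodies below, the [Node] branch of an [ECase] shifts the indices by 2, so
    the argument [v0] becomes [v2], then [v4]. *)
Fixpoint rest i a := if i is i'.+1 then esnd (rest i' a) else a.
Definition field i a := efst (rest i a).
Definition etrue := ENode ELeaf ELeaf.
Definition esingle a := ENode a ELeaf.

Definition EQ := 1.
Definition MEM := 2.
Definition DIFF := 3.
Definition NTH := 4.
Definition ADJ := 5.
Definition NBR := 6.
Definition NBRS := 7.
Definition LE := 8.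
Definition APP := 9.
Definition PLACE := 10.
Definition TRY := 11.
Definition RUN := 12.
Definition INIT := 13.
Definition DELTA := 14.
Definition CLOSE := 15.
Definition DEL := 16.
Definition MOV := 17.
Definition MOVES := 18.
Definition BRANCH := 19.
Definition STEP := 20.
Definition DFS := 21.
Definition IOTA := 22.

(* The comment above a body gives the layout of its argument; G is the digraph. *)

(* (x, y) *)
Definition eq_body :=
  ECase (field 0 v0) (ECase (rest 1 v0) etrue ELeaf)
    (ECase (rest 1 v2) ELeaf (ECall EQ <|v3, v1|>)).

(* (x, l) *)
Definition mem_body :=
  ECase (rest 1 v0) ELeaf
    (ECase (ECall EQ <|field 0 v2, v0|>) (ECall MEM <|field 0 v2, v1|>) etrue).

(* (l, l') *)
Definition diff_body :=
  ECase (field 0 v0) ELeaf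
    (ELet (ECall DIFF <|v1, rest 1 v2|>)
       (ECase (ECall MEM <|v1, rest 1 v3|>) <|v1, v0|> v2)).

(* (x, G) *)
Definition nth_body :=
  ECase (field 0 v0) (field 1 v0) (ECall NTH <|v1, rest 2 v2|>).

(* (G, x, y) *)
Definition adj_body :=
  ECase (ECall EQ (rest 1 v0))
    (ECall MEM <|rest 2 v0, ECall NTH <|field 1 v0, field 0 v0|> |>) etrue.

(* (G, y, A) *)
Definition nbr_body :=
  ECase (rest 2 v0) ELeaf
    (ECase (ECall ADJ <|field 0 v2, v0, field 1 v2|>)
       (ECall NBR <|field 0 v2, field 1 v2, v1|>) etrue).

(* (G, A, l) *)
Definition nbrs_body :=
  ECase (rest 2 v0) ELeaf
    (ELet (ECall NBRS <|field 0 v2, field 1 v2, v1|>)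
       (ECase (ECall NBR <|field 0 v3, v1, field 1 v3|>) v0 <|v3, v2|>)).

(* (a, b) *)
Definition le_body :=
  ECase (field 0 v0) etrue
    (ECase (rest 1 v2) ELeaf (ECall LE <|v3, v1|>)).

(* (l, l') *)
Definition app_body :=
  ECase (field 0 v0) (rest 1 v0) <|v0, ECall APP <|v1, rest 1 v2|> |>.

(* Sells to y the first object of price at most j that y wants; an object is a
   pair of a vertex and the list of its owners, latest first.
   (G, y, j, objs) *)
Definition place_body :=
  ECase (rest 3 v0) ELeaf
    (ECase (ECase (ECall LE <|rest 1 v0, field 2 v2|>) ELeaf
              (ECall ADJ <|field 0 v4, field 0 v2, field 1 v4|>))
       (ECase (ECall PLACE <|field 0 v2, field 1 v2, field 2 v2, v1|>)
          ELeaf <|v0, v2, v1|>)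
       <|rest 1 v2, <|field 0 v2, field 1 v4, rest 1 v2|>, v3|>).

(* The prices j, j + 1, ... are tried, as many as K is long.
   (G, y, j, K, objs) *)
Definition try_body :=
  ECase (field 3 v0) ELeaf
    (ECase (ECall PLACE <|field 0 v2, field 1 v2, field 2 v2, rest 4 v2|>)
       (ECall TRY <|field 0 v2, field 1 v2, <|ELeaf, field 2 v2|>, v1, rest 4 v2|>)
       <|v0, v1|>).

(* Returns the number of losers, for the queue q of bidders.
   (G, K, q, objs) *)
Definition run_body :=
  ECase (field 2 v0) ELeaf
    (ECase (ECall TRY <|field 0 v2, v0, ELeaf, field 1 v2, rest 3 v2|>)
       <|ELeaf, ECall RUN <|field 0 v2, field 1 v2, v1, rest 3 v2|> |>
       (ECall RUN <|field 0 v4, field 1 v4, ECase v0 v3 <|v0, v5|>, v1|>)).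

(* l *)
Definition init_body :=
  ECase v0 ELeaf <|esingle v0, ECall INIT v1|>.

Definition ediff a b := ECall DIFF <|a, b|>.

(* (G, U, W, A) *)
Definition delta_body :=
  ECall RUN <|field 0 v0, <|ELeaf, field 1 v0|>,
    ediff (field 1 v0) (ECall NBRS <|field 0 v0, rest 3 v0, field 1 v0|>),
    ECall INIT (ediff (ediff (field 1 v0) (rest 3 v0)) (field 2 v0))|>.

(* (G, U, W, A, l) *)
Definition close_body :=
  ECase (rest 4 v0) (field 3 v0)
    (ECall CLOSE <|field 0 v2, field 1 v2, field 2 v2,
       ECase
         (ECall LE
            <|ECall DELTA <|field 0 v2, field 1 v2, field 2 v2, field 3 v2|>,
            ECall DELTA <|field 0 v2, field 1 v2, field 2 v2, v0, field 3 v2|> |>)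
         (field 3 v2) <|v2, field 3 v4|>,
       v1|>).

(* The fields of a state are (U, Z, A, W, s, c). *)

(* (state, v) *)
Definition del_body :=
  ECase (field 4 (field 0 v0)) ELeaf
    (ELet (field 0 v2)
      (esingle <|ediff (field 0 v0) (esingle (rest 1 v3)),
         <|rest 1 v3, field 1 v0|>, field 2 v0,
         ediff (field 3 v0) (esingle (rest 1 v3)), v2, rest 5 v0|>)).

(* (state, t) *)
Definition mov_body :=
  ECase (rest 5 (field 0 v0)) ELeaf
    (ELet (field 0 v2)
      (esingle <|field 0 v0, field 1 v0, <|rest 1 v3, field 2 v0|>,
         ediff (field 3 v0) (esingle (rest 1 v3)), field 4 v0, v2|>)).

(* (state, l) *)
Definition moves_body :=
  ECase (rest 1 v0) ELeaf
    (ECall APP <|ECall MOV <|field 0 v2, v0|>,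
       ECall APP <|ECall DEL <|field 0 v2, v0|>,
         ECall MOVES <|field 0 v2, v1|> |> |>).

(* (G, r, state) *)
Definition branch_body :=
  ELet (rest 2 v0)
    (ECase (ECall NBRS <|field 0 v1, field 2 v0, ediff (field 0 v0) (field 2 v0)|>)
       (esingle <|ediff (field 0 v0) (field 2 v0), field 1 v0, ELeaf,
          field 3 v0, field 4 v0, field 1 v1|>)
       (ECall APP <|ECall DEL <|v2, v0|>,
          ECase (ECall MEM <|v0, field 3 v2|>)
            (esingle <|field 0 v2, field 1 v2, <|v0, field 2 v2|>, rest 3 v2|>)
            ELeaf|>)).

(* (G, r, state) *)
Definition step_body :=
  ELet (rest 2 v0)
    (ECall APP <|ECall MOVES <|v0, field 3 v0|>,
       ECall BRANCH <|field 0 v1, field 1 v1, field 0 v0, field 1 v0,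
         ECall CLOSE <|field 0 v1, field 0 v0, field 3 v0, field 2 v0,
           ediff (ediff (field 0 v0) (field 2 v0)) (field 3 v0)|>,
         rest 3 v0|> |>).

(* (G, r, fuel, states) *)
Definition dfs_body :=
  ECase (rest 3 v0) ELeaf
    (ECase (field 3 v0) <|ELeaf, field 1 v0|>
       (ECase
          (ECase (field 2 v4) ELeaf
             (ECall DFS <|field 0 (EVar 6), field 1 (EVar 6), v1,
                ECall STEP <|field 0 (EVar 6), field 1 (EVar 6), v4|> |>))
          (ECall DFS <|field 0 v4, field 1 v4, field 2 v4, v3|>)
          <|v0, v1|>)).

(* (i, l) *)
Definition iota_body :=
  ECase (rest 1 v0) ELeaf <|field 0 v2, ECall IOTA <|<|ELeaf, field 0 v2|>, v1|> |>.

(* (G, T, r, s) *)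
Definition main_body :=
  ECall DFS <|field 0 v0, field 2 v0,
    ECall APP <|field 1 v0, ECall APP <|field 1 v0, ECall APP <|field 1 v0,
      ECall APP <|field 1 v0, field 1 v0|> |> |> |>,
    esingle <|ECall IOTA <|ELeaf, field 0 v0|>, ELeaf, ELeaf, field 1 v0,
      rest 3 v0, field 2 v0|> |>.

Definition prog : program :=
  [:: main_body; eq_body; mem_body; diff_body; nth_body; adj_body; nbr_body;
      nbrs_body; le_body; app_body; place_body; try_body; run_body; init_body;
      delta_body; close_body; del_body; mov_body; moves_body; branch_body;
      step_body; dfs_body; iota_body].

(** * Evaluation within a time bound *)

Definition ev env a v B := exists2 t, eval prog env a v t & t <= B.
Definition call f x v B := ev [:: x] (nth ELeaf prog f) v B.

Lemma ev_conv env a v v' B B' : ev env a v B -> v = v' -> B <= B' -> ev env a v' B'.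
Proof. by move=> [t h1 h2] <- h3; exists t => //; apply: leq_trans h3. Qed.

Lemma ev_var env i v : nth Leaf env i = v -> ev env (EVar i) v 1.
Proof. by move=> <-; exists 1 => //; constructor. Qed.

Lemma ev_leaf env : ev env ELeaf Leaf 1.
Proof. by exists 1 => //; constructor. Qed.

Lemma ev_node env a b va vb ta tb :
  ev env a va ta -> ev env b vb tb -> ev env (ENode a b) (Node va vb) (ta + tb).+1.
Proof.
move=> [t h1 h2] [t' h3 h4]; exists (t + t').+1; first by constructor.
by rewrite ltnS leq_add.
Qed.

Lemma ev_let env a b va v ta tb :
  ev env a va ta -> ev (va :: env) b v tb -> ev env (ELet a b) v (ta + tb).+1.
Proof.
move=> [t h1 h2] [t' h3 h4]; exists (t + t').+1; first by econstructor; eauto.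
by rewrite ltnS leq_add.
Qed.

Lemma ev_call env f a va v ta tf :
  ev env a va ta -> call f va v tf -> ev env (ECall f a) v (ta + tf).+1.
Proof.
move=> [t h1 h2] [t' h3 h4]; exists (t + t').+1; first by econstructor; eauto.
by rewrite ltnS leq_add.
Qed.

(** Delays the choice of the branch until the value of the scrutinee has been found. *)
Variant ev_branch env b c : tree -> tree -> nat -> Prop :=
| ev_branchL v t of ev env b v t : ev_branch env b c Leaf v t
| ev_branchN x y v t of ev [:: x, y & env] c v t : ev_branch env b c (Node x y) v t.

Lemma ev_case env a b c va v ta t :
  ev env a va ta -> ev_branch env b c va v t -> ev env (ECase a b c) v (ta + t).+1.
Proof.
move=> [t1 h1 h2] h; case: h h1 => [v' t'|x y v' t'] [t3 h3 h4] h1;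
  exists (t1 + t3).+1; rewrite ?ltnS ?leq_add //.
  exact: eval_case_leaf h1 h3.
exact: eval_case_node h1 h3.
Qed.

Lemma ev_fst env a x y t : ev env a (Node x y) t -> ev env (efst a) x t.+2.
Proof.
move=> h; have := @ev_case env a ELeaf v0 (Node x y) x t 1 h.
by rewrite addn1; apply; apply: ev_branchN; apply: ev_var.
Qed.

Lemma ev_snd env a x y t : ev env a (Node x y) t -> ev env (esnd a) y t.+2.
Proof.
move=> h; have := @ev_case env a ELeaf v1 (Node x y) y t 1 h.
by rewrite addn1; apply; apply: ev_branchN; apply: ev_var.
Qed.

(** Symbolic execution of a body that adds up the costs; function calls are resolved by
    specifications in the context. *)
Ltac ev_go :=
  lazymatch goal with
  | |- ev _ (EVar _) _ _ => eapply ev_var; cbn [nth]; reflexivity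
  | |- ev _ ELeaf _ _ => apply ev_leaf
  | |- ev _ (ENode _ _) _ _ => eapply ev_node; [ev_go | ev_go]
  | |- ev _ (efst _) _ _ => eapply ev_fst; ev_go
  | |- ev _ (esnd _) _ _ => eapply ev_snd; ev_go
  | |- ev _ (field _ _) _ _ => unfold field; ev_go
  | |- ev _ (rest _ _) _ _ => progress lazy [rest]; ev_go
  | |- ev _ etrue _ _ => unfold etrue; ev_go
  | |- ev _ (esingle _) _ _ => unfold esingle; ev_go
  | |- ev _ (ediff _ _) _ _ => unfold ediff; ev_go
  | |- ev _ (ELet _ _) _ _ => eapply ev_let; [ev_go | ev_go]
  | |- ev _ (ECall _ _) _ _ => eapply ev_call; [ev_go | ev_spec]
  | |- ev _ (ECase _ _ _) _ _ => eapply ev_case; [ev_go | ev_go]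
  | |- ev_branch _ _ _ _ _ _ =>
      first [eapply ev_branchL | eapply ev_branchN]; ev_go
  end
with ev_spec :=
  try match goal with h : call ?f _ _ _ |- call ?f _ _ _ => exact h end.

Definition tn := tree_of_nat.
Definition tb (b : bool) := if b then Node Leaf Leaf else Leaf.
(** Any tree serves as a unary counter through its right spine: histories act as prices, lists of
    vertices as ranges of prices or as fuel. *)
Fixpoint spine t := if t is Node _ t' then (spine t').+1 else 0.

Lemma spine_tn m : spine (tn m) = m.
Proof. by elim: m => //= m ->. Qed.

Lemma spine_seq A (f : A -> tree) l : spine (tree_of_seq f l) = size l.
Proof. by elim: l => //= a l ->. Qed.

Ltac ev_end :=
  try match goal with h : call ?f _ _ _ |- call ?f _ _ _ => exact h end;
  (try done); (try by rewrite eqSS); (try lia).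
Ltac ev_body := eapply ev_conv; [ev_go | .. ]; ev_end.

Lemma call_eq x y : call EQ (Node (tn x) (tn y)) (tb (x == y)) (30 * x.+1).
Proof.
elim: x y => [|x IH] [|y]; rewrite /call /= /eq_body; ev_body.
Qed.

(** The bound involves only the second argument, so histories of any length can be compared with a
    price. *)
Lemma call_le x y : call LE (Node x y) (tb (spine x <= spine y)) (30 * (spine y).+1).
Proof.
elim: y x => [|y1 _ y IH] [|x1 x]; rewrite /call /= /le_body; ev_body.
Qed.

Lemma call_app A (f : A -> tree) l1 l2 :
  call APP (Node (tree_of_seq f l1) l2) (foldr (Node \o f) l2 l1) (30 * (size l1).+1).
Proof.
elim: l1 => [|x l1 IH]; rewrite /call /= /app_body; ev_body.
Qed.

Lemma call_app_seq A (f : A -> tree) l1 l2 :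
  call APP (Node (tree_of_seq f l1) (tree_of_seq f l2)) (tree_of_seq f (l1 ++ l2))
    (30 * (size l1).+1).
Proof. by rewrite /tree_of_seq foldr_cat; apply: call_app. Qed.

(** * List and graph operations of the program *)

Section Instance.
Variables (n : nat) (e : rel 'I_n).
Implicit Types (x y u v : 'I_n) (l A U W : seq 'I_n).

Notation N := n.+2.
Notation G := (tree_of_digraph e).
Definition tv l := tree_of_vertices l.

(** Each such constant bounds the cost of the function it is named after. The value [n.+2] of [N]
    leaves room for a range of [n + 1] prices. *)
Definition cEQ := 30 * N.
Definition cMEM := N * (cEQ + 30).
Definition cDIFF := N * (cMEM + 30).
Definition cADJ := cMEM + cEQ + 40 * N + 30.
Definition cNBR := N * (cADJ + 60).
Definition cNBRS := N * (cNBR + 60).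

Lemma call_eq_ord x y : call EQ (Node (tn x) (tn y)) (tb (x == y)) cEQ.
Proof.
apply: ev_conv (call_eq x y) _ _ => //.
rewrite leq_mul2l; have := ltn_ord x; lia.
Qed.

Lemma call_mem_size x l :
  call MEM (Node (tn x) (tv l)) (tb (x \in l)) ((size l).+1 * (cEQ + 30)).
Proof.
elim: l => [|y l IH]; rewrite /call /= /mem_body; first by ev_body.
rewrite inE; case: (boolP (x == y)) (call_eq_ord x y) => _ h; ev_body.
Qed.

Lemma call_mem x l : size l < N -> call MEM (Node (tn x) (tv l)) (tb (x \in l)) cMEM.
Proof. by move=> h; apply: ev_conv (call_mem_size x l) _ _ => //; apply: leq_mul. Qed.

Lemma call_diff l l' : size l < N -> size l' < N ->
  call DIFF (Node (tv l) (tv l')) (tv (diff l l')) cDIFF.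
Proof.
move=> h h'; suff: call DIFF (Node (tv l) (tv l')) (tv (diff l l'))
    ((size l).+1 * (cMEM + 30)).
  by move=> hc; apply: ev_conv hc _ _ => //; apply: leq_mul.
elim: l {h} => [|y l IH]; rewrite /call /= /diff_body; first by ev_body.
case: (boolP (y \in l')) (call_mem y h') => _ hc;
  by ev_body.
Qed.

Lemma call_nth i (s : seq 'I_n) x0 : i < size s ->
  call NTH (Node (tn i) (tree_of_seq (fun u => tv (enum (e u))) s))
    (tv (enum (e (nth x0 s i)))) (30 * i.+1).
Proof.
elim: s i => [|y s IH] [|i] //= h; [|have {}IH := IH i h]; rewrite /call /= /nth_body; ev_body.
Qed.

Lemma call_adj x y :
  call ADJ (Node G (Node (tn x) (tn y))) (tb (adj e x y)) cADJ.
Proof.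
rewrite /call /= /adj_body /adj /cADJ.
have hn : call NTH (Node (tn x) G) (tv (enum (e x))) (30 * N).
  have hx : x < size (enum 'I_n) by rewrite size_enum_ord.
  apply: ev_conv (call_nth x hx) _ _ => //; first by rewrite nth_ord_enum.
  by have := ltn_ord x; lia.
have hm : call MEM (Node (tn y) (tv (enum (e x)))) (tb (e x y)) cMEM.
  have hs : size (enum (e x)) < N.
    by have := max_card (e x); rewrite -cardE card_ord; lia.
  by apply: ev_conv (call_mem y hs) _ _ => //; rewrite mem_enum.
case: (boolP (x == y)) (call_eq_ord x y) => _ h; ev_body.
Qed.

Lemma call_nbr A y : size A < N ->
  call NBR (Node G (Node (tn y) (tv A))) (tb (nbr e A y)) cNBR.
Proof.
move=> h; suff: call NBR (Node G (Node (tn y) (tv A))) (tb (nbr e A y))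
    ((size A).+1 * (cADJ + 60)).
  by move=> hc; apply: ev_conv hc _ _ => //; apply: leq_mul.
elim: A {h} => [|x A IH]; rewrite /call /= /nbr_body; first by ev_body.
case: (boolP (adj e x y)) (call_adj x y) => _ hc;
  ev_body.
Qed.

Lemma call_nbrs A l : size A < N -> size l < N ->
  call NBRS (Node G (Node (tv A) (tv l))) (tv (nbrs e A l)) cNBRS.
Proof.
move=> h h'; suff: call NBRS (Node G (Node (tv A) (tv l))) (tv (nbrs e A l))
    ((size l).+1 * (cNBR + 60)).
  by move=> hc; apply: ev_conv hc _ _ => //; apply: leq_mul.
elim: l {h'} => [|y l IH]; rewrite /call /= /nbrs_body; first by ev_body.
case: (boolP (nbr e A y)) (call_nbr y h) => _ hc;
  by ev_body.
Qed.

(** * The auction *)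

Definition obj : Type := 'I_n * seq 'I_n.
Implicit Types (os : seq obj) (o : obj).

Definition tobj o := Node (tn o.1) (tv o.2).
Definition tobjs := tree_of_seq tobj.

Fixpoint place y j os : option (seq 'I_n * seq obj) :=
  if os is o :: os' then
    if (size o.2 <= j) && adj e o.1 y then Some (o.2, (o.1, y :: o.2) :: os')
    else omap (fun r => (r.1, o :: r.2)) (place y j os')
  else None.

Definition tplace (r : option (seq 'I_n * seq obj)) :=
  if r is Some (h, os) then Node (tv h) (tobjs os) else Leaf.

Definition cPLACE := N * (30 * N + cADJ + 150).

Lemma call_le_hist h j : j < N ->
  call LE (Node (tv h) (tn j)) (tb (size h <= j)) (30 * N).
Proof.
move=> hj; apply: ev_conv (call_le (tv h) (tn j)) _ _; first by rewrite spine_seq spine_tn.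
by rewrite spine_tn; lia.
Qed.

Lemma call_place y j os : size os < N -> j < N ->
  call PLACE (Node G (Node (tn y) (Node (tn j) (tobjs os)))) (tplace (place y j os)) cPLACE.
Proof.
move=> h hj; suff: call PLACE (Node G (Node (tn y) (Node (tn j) (tobjs os))))
    (tplace (place y j os)) ((size os).+1 * (30 * N + cADJ + 150)).
  by move=> hc; apply: ev_conv hc _ _ => //; apply: leq_mul.
elim: os {h} => [|[x h] os IH]; rewrite /call /= /place_body; first by ev_body.
have hl := call_le_hist h hj; have ha := call_adj x y.
case: (boolP (size h <= j)) hl => _ hl /=; last first.
  by case: (place y j os) IH => [[h' os']|] /= IH; ev_body.
case: (boolP (adj e x y)) ha => _ ha /=; first by ev_body.
by case: (place y j os) IH => [[h' os']|] /= IH; ev_body.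
Qed.

Fixpoint try_place y j m os :=
  if m is m'.+1 then
    if place y j os is Some r then Some r else try_place y j.+1 m' os
  else None.

Definition cTRY := N * (cPLACE + 150).

Lemma call_try y j t os : size os < N -> j + spine t <= N -> spine t < N ->
  call TRY (Node G (Node (tn y) (Node (tn j) (Node t (tobjs os)))))
    (tplace (try_place y j (spine t) os)) cTRY.
Proof.
move=> h hj ht; suff: call TRY (Node G (Node (tn y) (Node (tn j) (Node t (tobjs os)))))
    (tplace (try_place y j (spine t) os)) ((spine t).+1 * (cPLACE + 150)).
  by move=> hc; apply: ev_conv hc _ _ => //; apply: leq_mul.
elim: t j hj {ht} => [|t1 _ t IH] j /= hj; rewrite /call /= /try_body; first by ev_body.
have {}IH := IH j.+1 _; rewrite addSnnS in IH; have {}IH := IH hj.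
have := call_place y h (_ : j < N); case: (place y j os) => [[h' os']|] /= hp.
  by have {}hp := hp ltac:(lia); ev_body.
by have {}hp := hp ltac:(lia); ev_body.
Qed.

Lemma placeP y j os :
  match place y j os with
  | Some (h, os') => exists s1 x s2, [/\ os = s1 ++ (x, h) :: s2,
      os' = s1 ++ (x, y :: h) :: s2, adj e x y & size h <= j]
  | None => forall o, o \in os -> adj e o.1 y -> j < size o.2
  end.
Proof.
elim: os => [|[x h] os IH] //=; case: ifP => [/andP[hj ha]|hn].
  by exists [::], x, os.
case: (place y j os) IH => [[h' os']|] /=.
  by move=> [s1 [x' [s2 [-> -> ha hj]]]]; exists ((x, h) :: s1), x', s2.
move=> IH o; rewrite inE => /predU1P[-> /= ha|/IH //].
by move: hn; rewrite ha andbT => /negbT; rewrite -ltnNge.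
Qed.

(** Each failed price [j] shows that all objects wanted by [y] cost more, so the first success is a
    cheapest wanted object. *)
Lemma try_placeP y j m os : {in os, forall o, adj e o.1 y -> j <= size o.2} ->
  match try_place y j m os with
  | Some (h, os') => exists s1 x s2, [/\ os = s1 ++ (x, h) :: s2,
      os' = s1 ++ (x, y :: h) :: s2, adj e x y, size h < j + m
      & {in os, forall o, adj e o.1 y -> size h <= size o.2}]
  | None => {in os, forall o, adj e o.1 y -> j + m <= size o.2}
  end.
Proof.
elim: m j => [|m IH] j hj /=; first by rewrite addn0.
case: (place y j os) (placeP y j os) => [[h os'] [s1 [x [s2 [h1 h2 h3 h4]]]]|hn].
  exists s1, x, s2; split=> //; first lia.
  by move=> o /hj ho /ho; apply: leq_trans.
by rewrite addnS -addSn; apply: IH => o /hn.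
Qed.

Definition owners os := flatten [seq take 1 o.2 | o <- os].

(* Histories serve as prices: an object has been sold [size o.2] times, and its
   owner bought it at the lowest price then asked among the objects it wants. *)
Record auction_inv (Y M : seq 'I_n) K q os (F : seq 'I_n) : Prop := AuctionInv {
  auction_bidders : perm_eq (q ++ F ++ owners os) Y;
  auction_objects : unzip1 os = M;
  auction_owner : {in os, forall o y h, o.2 = y :: h ->
    adj e o.1 y /\ {in os, forall o', adj e o'.1 y -> size h <= size o'.2}};
  auction_lost : {in F, forall y, {in os, forall o, adj e o.1 y -> K <= size o.2}};
  auction_price : {in os, forall o, size o.2 <= K} }.

Lemma owners_cat os1 os2 : owners (os1 ++ os2) = owners os1 ++ owners os2.
Proof. by rewrite /owners map_cat flatten_cat. Qed.

Lemma auction_sell Y M K y q s1 x h s2 F : adj e x y -> size h < K ->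
  {in s1 ++ (x, h) :: s2, forall o, adj e o.1 y -> size h <= size o.2} ->
  auction_inv Y M K (y :: q) (s1 ++ (x, h) :: s2) F ->
  auction_inv Y M K (take 1 h ++ q) (s1 ++ (x, y :: h) :: s2) F.
Proof.
move=> hxy hK hmin [hY hM ho hF hp].
have up o' : o' \in s1 ++ (x, y :: h) :: s2 ->
    o' = (x, y :: h) \/ o' \in s1 ++ (x, h) :: s2.
  by rewrite !mem_cat !inE => /orP[->|/predU1P[->|->]]; rewrite ?orbT; auto.
have lift b z : {in s1 ++ (x, h) :: s2, forall o', adj e o'.1 z -> b <= size o'.2} ->
    {in s1 ++ (x, y :: h) :: s2, forall o', adj e o'.1 z -> b <= size o'.2}.
  move=> hb o' /up[-> /= hz|/hb //]; apply: leq_trans (leqnSn _).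
  by apply: (hb (x, h)) => //; rewrite mem_cat inE eqxx orbT.
split.
- apply: perm_trans hY; rewrite !owners_cat /owners /= take0 /=.
  apply/permP => a; rewrite /= !count_cat /=; lia.
- by rewrite -hM /unzip1 !map_cat.
- move=> o /up[-> z h' /= [<- <-]|hoo z h' hz]; first by split=> //; apply: lift.
  by have [h1 h2] := ho _ hoo _ _ hz; split=> //; apply: lift.
- by move=> z /hF; apply: lift.
by move=> o /up[->//|/hp].
Qed.

Lemma auction_lose Y M K y q os F :
  {in os, forall o, adj e o.1 y -> K <= size o.2} ->
  auction_inv Y M K (y :: q) os F -> auction_inv Y M K q os (y :: F).
Proof.
move=> hy [hY hM ho hF hp]; split=> //.
  by apply: perm_trans hY; apply/permP => a; rewrite /= !count_cat /= count_cat; lia.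
by move=> z; rewrite inE => /predU1P[->//|/hF].
Qed.

Definition room K os := sumn [seq K - size o.2 | o <- os].

Lemma call_run Y M t m q os F : let K := spine t in
  K < N -> size M < N -> auction_inv Y M K q os F -> room K os + size q <= m ->
  exists F' os', [/\ auction_inv Y M K [::] os' F', size F <= size F' &
    call RUN (Node G (Node t (Node (tv q) (tobjs os)))) (tn (size F' - size F))
      (m.+1 * (cTRY + 250))].
Proof.
move=> K hK hM; elim: m q os F => [|m IH] [|y q] os F hI hm.
- exists F, os; rewrite subnn /call /= /run_body; split=> //; ev_body.
- by rewrite addnS in hm.
- exists F, os; rewrite subnn /call /= /run_body; split=> //; ev_body.
have hos : size os < N by rewrite -(size_map fst) -[map _ _]/(unzip1 os) (auction_objects hI).
rewrite /call /= /run_body.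
have ht : call TRY _ (tplace (try_place y 0 K os)) _ := call_try y (j := 0) hos (ltnW hK) hK.
have := @try_placeP y 0 K os (fun _ _ _ => leq0n _); rewrite add0n.
case: (try_place y 0 K os) ht => [[h os']|] /= ht; last first.
  move=> hy; have hI' := auction_lose hy hI.
  have [|F' [os' [h1 h2 h3]]] := IH _ _ _ hI'; first by move: hm; rewrite /= addnS.
  exists F', os'; split=> //; first exact: ltnW.
  have -> : size F' - size F = (size F' - (size F).+1).+1 by move: h2 => /=; lia.
  by ev_body.
move=> [s1 [x [s2 [eos eos' hxy hhK hmin]]]]; subst os os'.
have hI' := auction_sell hxy hhK hmin hI.
have [|F' [os' [h1 h2 h3]]] := IH _ _ _ hI'.
  move: hm; rewrite /room !map_cat !sumn_cat /= !size_cat /= size_take; case: ifP; lia.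
exists F', os'; split=> //.
case: h {hmin hI hI' hhK hm hos} ht h3 => [|z h] /=; rewrite ?take0 => ht h3; ev_body.
Qed.

End Instance.

(** * The auction computes minimum cuts *)

Section Auction.
Variables (n : nat) (e : rel 'I_n).
Notation N := n.+2.
Notation G := (tree_of_digraph e).
Implicit Types (x y u v : 'I_n) (l A U W : seq 'I_n) (os : seq (obj n)).

Lemma count_owners (a : pred 'I_n) (b : pred (obj n)) os :
  {in os, forall o y h, o.2 = y :: h -> a y -> b o} ->
  count a (owners os) <= count b os.
Proof.
elim: os => //= -[x h] os IH hab; rewrite /owners /= count_cat leq_add //.
  case: h hab => [//|y h] /(_ (x, y :: h) (mem_head _ _) y h erefl) /=.
  by rewrite take0 addn0; case: (a y) => // ->.
by apply: IH => o ho; apply: hab; rewrite inE ho orbT.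
Qed.

Lemma owners_filter_subseq (b : pred (obj n)) os :
  subseq (owners (filter b os)) (owners os).
Proof.
elim: os => //= o os IH; case: ifP => _; rewrite /owners /=; first exact: cat_subseq.
by apply: subseq_trans IH (suffix_subseq _ _).
Qed.

Lemma size_owners os : all (fun o => 0 < size o.2) os -> size (owners os) = size os.
Proof.
elim: os => //= -[x [|y h]] os IH //= /IH h'; by rewrite /owners /= take0 /= h'.
Qed.

(** Otherwise [f] would drop strictly [K] times from a value below [K]. *)
Lemma antitone_plateau (f : nat -> nat) K : f 0 < K -> exists2 j, j < K & f j <= f j.+1.
Proof.
move=> hK; have [/hasP[j]|/hasPn h] := boolP (has (fun j => f j <= f j.+1) (iota 0 K)).
  by rewrite mem_iota => hj hf; exists j.
have : forall j, j <= K -> f j + j <= f 0.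
  elim=> [|j IH] hj; first by rewrite addn0.
  have /h : j \in iota 0 K by rewrite mem_iota.
  by have := IH (ltnW hj); rewrite -ltnNge; lia.
by move/(_ K (leqnn _)); lia.
Qed.

(** Every bidder of [P] has lost or owns an object, and an object has at most one owner, who wants
    it. *)
Lemma auction_upper Y M K os F (P : {set 'I_n}) :
  uniq Y -> uniq M -> auction_inv e Y M K [::] os F -> {subset P <= Y} ->
  #|P| <= size F + #|wants e [set:: M] P|.
Proof.
move=> hY hM hI hP.
have -> : #|P| = count (mem P) Y.
  rewrite -size_filter -(card_uniqP (filter_uniq _ hY)); apply: eq_card => y.
  by rewrite mem_filter /=; case: (boolP (y \in P)) => [yP|//]; rewrite (hP y yP).
rewrite -(permP (auction_bidders hI)) /= count_cat leq_add ?count_size //.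
set w := wants _ _ _; have -> : #|w| = count (fun o => o.1 \in w) os.
  rewrite -(count_map fst (mem w)) -/(unzip1 os) (auction_objects hI) -size_filter.
  rewrite -(card_uniqP (filter_uniq _ hM)); apply: eq_card => x.
  rewrite mem_filter /=; case: (boolP (x \in w)) => //.
  by rewrite !inE => /andP[->].
apply: count_owners => o ho y h ey yP.
have [hxy _] := auction_owner hI ho ey; rewrite !inE.
rewrite -(auction_objects hI) map_f //=; by apply/existsP; exists y; apply/andP; split.
Qed.

(* At a plateau of the number of objects of price at least j, the bidders who
   lost or own an object dearer than j want no object cheaper than j. *)
Lemma auction_lower Y M K os F :
  uniq Y -> uniq M -> size M < K -> auction_inv e Y M K [::] os F ->
  exists2 P : {set 'I_n}, {subset P <= Y} & size F + #|wants e [set:: M] P| <= #|P|.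
Proof.
move=> hY hM hK hI.
pose f j := count (fun o : obj n => j <= size o.2) os.
have [|j hj hf] := @antitone_plateau f K.
  by rewrite /f; apply: leq_ltn_trans hK; rewrite -(auction_objects hI) size_map count_size.
pose p := F ++ owners [seq o <- os | j < size o.2].
have hsub : subseq p (F ++ owners os) by rewrite cat_subseq // owners_filter_subseq.
have hperm := auction_bidders hI; rewrite /= in hperm.
have hp : uniq p by apply: subseq_uniq hsub _; rewrite (perm_uniq hperm).
exists [set:: p].
  by move=> y; rewrite inE => /(mem_subseq hsub); rewrite (perm_mem hperm).
rewrite card_seq // size_cat leq_add2l size_owners; last first.
  by apply/allP => o; rewrite mem_filter => /andP[]; case: (size _).
(* Every object dearer than [j] has an owner in [P]; by the plateau it remains to see that all
   objects wanted by [P] cost at least [j]. *)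
rewrite size_filter; apply: leq_trans hf; rewrite /f -size_filter.
rewrite -[X in _ <= X](size_map fst); apply: leq_trans (card_size _).
apply: subset_leq_card; apply/subsetP => x; rewrite !inE -(auction_objects hI).
move=> /andP[/mapP[o' ho' ->] /existsP[y /andP[]]].
rewrite inE mem_cat => hy hxy; apply/mapP; exists o' => //; rewrite mem_filter ho' andbT.
case/orP: hy => [yF|/flattenP[s /mapP[o]]].
  by apply: leq_trans (ltnW hj) _; apply: (auction_lost hI yF ho').
rewrite mem_filter => /andP[hoj ho] ->; case E: o.2 => [//|z h]; rewrite /= take0 inE => /eqP yz.
have [_ hmin] := auction_owner hI ho E.
by rewrite E ltnS in hoj; apply: leq_trans hoj _; apply: hmin ho' _; rewrite -yz.
Qed.

Lemma call_init l :
  call INIT (tv l) (tobjs [seq (x, [::]) | x <- l]) (30 * (size l).+1).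
Proof. by elim: l => [|x l IH]; rewrite /call /= /init_body; ev_body. Qed.

Definition cRUN := (N * N + N).+1 * (cTRY n + 250).
Definition cDELTA := cRUN + 3 * cDIFF n + cNBRS n + 30 * N + 200.

Lemma size_uniq l : uniq l -> size l <= n.
Proof. by move=> /card_uniqP <-; rewrite -[n in X in _ <= X]card_ord max_card. Qed.

(** The number of losers is [size W - lam] by [lam_deficiency], whose two hypotheses are
    [auction_upper] and [auction_lower]. *)
Lemma call_delta U W A : uniq U -> uniq W -> uniq A ->
  {subset A <= U} -> {subset W <= U} -> {in A, forall x, x \notin W} ->
  listlam e U W A <= size W /\
  call DELTA (Node G (Node (tv U) (Node (tv W) (tv A))))
    (tn (size W - listlam e U W A)) cDELTA.
Proof.
move=> hU hW hA hAU hWU hAW.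
have sU := size_uniq hU; have sW := size_uniq hW; have sA := size_uniq hA.
(* The counter [t] has length [size U + 1], so there are more prices than objects, as
   [auction_lower] requires. *)
pose Y := diff U (nbrs e A U); pose M := diff (diff U A) W; pose t := Node Leaf (tv U).
have hY : uniq Y by apply: diff_uniq.
have hM : uniq M by do 2 apply: diff_uniq.
have sY := size_uniq hY.
have sM : size M <= size U by rewrite /M /diff -filter_predI size_filter count_size.
have ht : spine t = (size U).+1 by rewrite /= spine_seq.
pose os0 : seq (obj n) := [seq (x, [::]) | x <- M].
have hI0 : auction_inv e Y M (spine t) Y os0 [::].
  split=> //; last by move=> o /mapP[x _ ->].
  - have -> : owners os0 = [::] by rewrite /owners /os0; elim: (M) => //= x M' ->.
    by rewrite /= cats0 perm_refl.
  - by rewrite /unzip1 -map_comp map_id.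
  - by move=> o /mapP[x _ ->] y h.
have [|||F [os [hI _ hrun]]] := @call_run _ e Y M t (N * N + N) _ _ _ _ _ hI0.
- by rewrite ht.
- by apply: leq_ltn_trans sM _; rewrite ltnS leqW.
- rewrite leq_add //; last by rewrite ltnW // ltnS ltnW.
  have hr : room (spine t) os0 <= size M * spine t.
    rewrite /room /os0; elim: (M) => //= x M' IH; rewrite subn0 mulSn leq_add2l //.
  by apply: leq_trans hr _; apply: leq_mul; rewrite ?ht; clear -sM sU; lia.
have hdef : size F + listlam e U W A = size W.
  rewrite -(card_seq hW); apply: lam_deficiency.
  - exact: feasible_seq.
  - by apply/subsetP => x; rewrite !inE; apply: hWU.
  - move=> P hP; rewrite -!set_diff; apply: auction_upper hI _ => // y yP.
    have := subsetP hP y yP; rewrite in_setD inE -nbrE mem_diff mem_filter.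
    by case/andP => [h1 ->]; rewrite (negPf h1).
  have [|P hP hlow] := auction_lower hY hM _ hI; first by rewrite ht.
  exists P; last by rewrite -!set_diff.
  apply/subsetP => y /hP; rewrite in_setD inE -nbrE mem_diff mem_filter.
  by case/andP => ->; rewrite !andbT.
split; first by rewrite -hdef leq_addl.
have -> : size W - listlam e U W A = size F - 0 by rewrite -hdef addnK subn0.
have ltN m : m <= n -> m < N by rewrite ltnS => /leqW.
have sD l l' : size l <= n -> size (diff l l') <= n.
  by rewrite /diff size_filter; apply: leq_trans (count_size _ _).
have sB : size (nbrs e A U) <= n.
  by rewrite /nbrs size_filter; apply: leq_trans (count_size _ _) sU.
have h1 := call_nbrs e (ltN _ sA) (ltN _ sU).
have h2 := call_diff (ltN _ sU) (ltN _ sB).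
have h3 := call_diff (ltN _ sU) (ltN _ sA).
have h4 := call_diff (ltN _ (sD U A sU)) (ltN _ sW).
have h5 : call INIT (tv M) (tobjs os0) (30 * N).
  by apply: ev_conv (call_init M) _ _ => //; rewrite leq_mul2l ltnS (leq_trans sM (leqW sU)).
rewrite -[_ * _]/cRUN in hrun.
rewrite /call /= /delta_body; ev_body.
by rewrite /cDELTA; clear; lia.
Qed.

Definition cCLOSE := N * (2 * cDELTA + 30 * N + 300).

Lemma call_close U W A l : uniq U -> uniq W -> uniq (A ++ l) ->
  {subset A ++ l <= U} -> {subset W <= U} -> {in A ++ l, forall x, x \notin W} ->
  call CLOSE (Node G (Node (tv U) (Node (tv W) (Node (tv A) (tv l)))))
    (tv (close e U W A l)) cCLOSE.
Proof.
move=> hU hW hA hAU hWU hAW.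
suff: call CLOSE (Node G (Node (tv U) (Node (tv W) (Node (tv A) (tv l)))))
    (tv (close e U W A l)) ((size l).+1 * (2 * cDELTA + 30 * N + 300)).
  move=> h; apply: ev_conv h _ _ => //; rewrite leq_mul //.
  have := size_uniq hA; rewrite size_cat ltnS => /(leq_trans (leq_addl _ _)).
  exact: leqW.
elim: l A hA hAU hAW => [|u l IH] A hA hAU hAW; rewrite /call /= /close_body.
  by ev_body.
have hperm : perm_eq (u :: A ++ l) (A ++ u :: l).
  by rewrite perm_sym; apply/permPl; apply: (perm_catCA A [:: u] l).
have hA1 := perm_uniq hperm; rewrite hA in hA1.
have hm x : x \in (u :: A) ++ l -> x \in A ++ u :: l by rewrite -(perm_mem hperm).
have hml x : x \in A ++ l -> x \in A ++ u :: l by move=> h; apply: hm; rewrite inE h orbT.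
have hmA x : x \in A -> x \in A ++ l by rewrite mem_cat => ->.
have hmA1 x : x \in u :: A -> x \in (u :: A) ++ l by rewrite mem_cat => ->.
have uA : uniq A by move: hA; rewrite cat_uniq => /andP[].
have uA1 : uniq (u :: A) by move: hA1; rewrite -cat_cons cat_uniq => /andP[].
have [hl1 hc1] := @call_delta U W A hU hW uA (fun x h => hAU x (hml x (hmA x h))) hWU
  (fun x h => hAW x (hml x (hmA x h))).
have [hl2 hc2] := @call_delta U W (u :: A) hU hW uA1 (fun x h => hAU x (hm x (hmA1 x h))) hWU
  (fun x h => hAW x (hm x (hmA1 x h))).
(* [DELTA] returns [size W - lam], which reverses the comparison; since [lam] is at most [size W],
   truncated subtraction does no harm. *)
have hle : call LE (Node (tn (size W - listlam e U W A)) (tn (size W - listlam e U W (u :: A))))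
   (tb (listlam e U W (u :: A) <= listlam e U W A)) (30 * N).
  apply: ev_conv (call_le _ _) _ _; rewrite !spine_tn; last first.
    rewrite leq_mul2l /= ltnS (leq_trans (leq_subr _ _)) //.
    exact: leqW (size_uniq hW).
  by rewrite leq_sub2lE.
case: ifP hle => hif hle.
  have {}IH := IH (u :: A) hA1 (fun x h => hAU x (hm x h)) (fun x h => hAW x (hm x h)).
  by ev_body; clear; lia.
have {}IH : call CLOSE _ _ _ := IH A _ (fun x h => hAU x (hml x h)) (fun x h => hAW x (hml x h)).
have {}IH := IH ltac:(by case/andP: hA1).
by ev_body; clear; lia.
Qed.

End Auction.

(** * The search program and its cost *)

Section Search.
Variables (n : nat) (e : rel 'I_n) (T : {set 'I_n}) (r : nat).
Notation N := n.+2.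
Notation G := (tree_of_digraph e).
Implicit Types (x y u v : 'I_n) (l A U W : seq 'I_n) (st : state 'I_n).

Definition tst st :=
  Node (tv (alive st)) (Node (tv (deleted st)) (Node (tv (inside st))
    (Node (tv (outside st)) (Node (tn (budget st)) (tn (capacity st)))))).
Definition tsts := tree_of_seq tst.

Definition cMOVE := 2 * cDIFF n + 300.

Lemma call_del st v : size (alive st) <= n -> size (outside st) <= n ->
  call DEL (Node (tst st) (tn v)) (tsts (del_succ st v)) cMOVE.
Proof.
case: st => U Z A W [|s] c /= hU hW; rewrite /call /= /del_body.
  by ev_body; rewrite /cMOVE; clear; lia.
have h1 := @call_diff n U [:: v] (leqW hU) isT.
have h2 := @call_diff n W [:: v] (leqW hW) isT.
by ev_body; rewrite /cMOVE; clear; lia.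
Qed.

Lemma call_mov st v : size (outside st) <= n ->
  call MOV (Node (tst st) (tn v)) (tsts (mov_succ st v)) cMOVE.
Proof.
case: st => U Z A W s [|c] /= hW; rewrite /call /= /mov_body.
  by ev_body; rewrite /cMOVE; clear; lia.
have h2 := @call_diff n W [:: v] (leqW hW) isT.
by ev_body; rewrite /cMOVE; clear; lia.
Qed.

Lemma size_del_succ st v : size (del_succ st v) <= 1.
Proof. by rewrite /del_succ; case: budget. Qed.

Lemma size_mov_succ st v : size (mov_succ st v) <= 1.
Proof. by rewrite /mov_succ; case: capacity. Qed.

Lemma size_moves st l : size (moves st l) <= 2 * size l.
Proof.
elim: l => //= t l IH; rewrite !size_cat mulnS addnA leq_add //.
exact: leq_add (size_mov_succ st t) (size_del_succ st t).
Qed.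

Definition cMOVES := N * (2 * cMOVE + 300).

Lemma call_moves st l : size (alive st) <= n -> size (outside st) <= n -> size l <= n ->
  call MOVES (Node (tst st) (tv l)) (tsts (moves st l)) cMOVES.
Proof.
move=> hU hW hl; suff: call MOVES (Node (tst st) (tv l)) (tsts (moves st l))
    ((size l).+1 * (2 * cMOVE + 300)).
  by move=> h; apply: ev_conv h _ _ => //; rewrite leq_mul // ltnW.
elim: l {hl} => [|t l IH]; rewrite /call /= /moves_body; first by ev_body.
have h1 := call_mov t hW; have h2 := call_del t hU hW.
have h3 := call_app_seq tst (del_succ st t) (moves st l).
have h4 := call_app_seq tst (mov_succ st t) (del_succ st t ++ moves st l).
have := size_del_succ st t; have := size_mov_succ st t => hs1 hs2.
ev_body.
move: hs1 hs2; set a := size _; set b := size _; set c := size _.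
by move: a b c; clear; lia.
Qed.

Definition cBRANCH := 2 * cDIFF n + cNBRS n + cMOVE + cMEM n + 500.

Lemma call_branch st :
  size (alive st) <= n -> size (outside st) <= n -> size (inside st) <= n ->
  call BRANCH (Node G (Node (tn r) (tst st))) (tsts (branch e r st)) cBRANCH.
Proof.
move=> hU hW hA.
have h1 := call_diff (leqW hU : _ < N) (leqW hA : _ < N).
have hD : size (diff (alive st) (inside st)) <= n.
  by rewrite /diff size_filter; apply: leq_trans (count_size _ _) _.
have h2 := call_nbrs e (leqW hA : _ < N) (leqW hD : _ < N).
rewrite /call /= /branch_body /branch.
case: (nbrs e (inside st) (diff (alive st) (inside st))) h2 => [|v vs] h2.
  by ev_body; rewrite /cBRANCH; clear; lia.
have h3 := call_del v hU hW.
have h4 := call_mem v (leqW hW : _ < N).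
have h5 := call_app_seq tst (del_succ st v) (add_succ st v).
have := size_del_succ st v; rewrite /add_succ in h5 *.
case: (v \in outside st) h4 h5 => h4 h5 hs; ev_body; move: hs; rewrite /cBRANCH;
  set a := size _; by move: a; clear; lia.
Qed.

Lemma size_branch st : size (branch e r st) <= 2.
Proof.
rewrite /branch; case: nbrs => // v _; rewrite size_cat /add_succ.
by apply: leq_add (size_del_succ st v) _; case: ifP.
Qed.

Lemma size_step st : size (step e r st) <= 2 * size (outside st) + 2.
Proof. by rewrite size_cat leq_add ?size_moves ?size_branch. Qed.

Definition cSTEP := cMOVES + cBRANCH + cCLOSE n + 2 * cDIFF n + 60 * N + 500.

Lemma call_step s0 st : inv e T r s0 st ->
  call STEP (Node G (Node (tn r) (tst st))) (tsts (step e r st)) cSTEP.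
Proof.
move=> hI; have hI' := inv_closed hI.
have hU := size_uniq (inv_Uu hI); have hA := size_uniq (inv_Au hI).
have hW := size_uniq (inv_Wu hI).
have hD : size (diff (alive st) (inside st)) <= n.
  by rewrite /diff size_filter; apply: leq_trans (count_size _ _) _.
have h1 := call_diff (leqW hU : _ < N) (leqW hA : _ < N).
have h2 := call_diff (leqW hD : _ < N) (leqW hW : _ < N).
have [hf1 hf2 hf3] := inv_free hI.
have h3 := call_close e (inv_Uu hI) (inv_Wu hI) hf1 hf2 (inv_WU hI) hf3.
have h4 := call_moves hU hW hW.
have h5 := call_branch (st := closed e st) hU hW (size_uniq (inv_Au hI')).
have h6 := call_app_seq tst (moves st (outside st)) (branch e r (closed e st)).
have hs := size_moves st (outside st).
have {}hs : size (moves st (outside st)) <= 2 * n.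
  by apply: leq_trans hs _; rewrite leq_mul2l.
rewrite /call /= /step_body; ev_body.
by move: hs; set a := size _; move: a; rewrite /cSTEP; clear; lia.
Qed.

Notation search := (search e r).

(** [DFS] descends into successors and runs through a list of states in one function, so its
    specification concerns lists. *)
Definition search_all f (l : seq (state 'I_n)) :=
  foldr (fun st res => if search f st is Some z then Some z else res) None l.

Definition tout (res : option (seq 'I_n)) :=
  if res is Some z then Node Leaf (tv z) else Leaf.

(** The cost per listed state: a state has at most [2 * k + 2] successors, and one more unit in the
    base pays for the state's own step. *)
Definition cDFS k f := (cSTEP + 500) * (2 * k + 3) ^ f.

Lemma call_dfs s0 t (l : seq (state 'I_n)) : {in l, forall st, inv e T r s0 st} ->
  call DFS (Node G (Node (tn r) (Node t (tsts l)))) (tout (search_all (spine t) l))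
    (size l * cDFS #|T| (spine t) + 40).
Proof.
elim: t l => [|t1 _ t IH] l.
  elim: l => [|[U Z A W s c] l IHl] hl; rewrite /call /= /dfs_body; first by ev_body.
  have {}IHl := IHl (fun st h => hl st (@mem_behead _ (_ :: l) st h)).
  rewrite /= in IHl; case: W hl => [|w W] hl; ev_body; rewrite /cDFS; clear; lia.
have stepC st : inv e T r s0 st ->
  call DFS (Node G (Node (tn r) (Node t (tsts (step e r st)))))
    (tout (search_all (spine t) (step e r st)))
    ((2 * #|T| + 2) * cDFS #|T| (spine t) + 40).
  move=> hI; apply: ev_conv (IH _ _) _ _ => //; first by move=> st' /(inv_step hI).
  rewrite leq_add2r leq_mul2r; apply/orP; right.
  apply: leq_trans (size_step st) _; rewrite leq_add2r leq_mul2l /=.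
  rewrite -card_seq ?(inv_Wu hI) //; apply: subset_leq_card; apply/subsetP => x.
  by rewrite inE; apply: (inv_WT hI).
elim: l => [|st l IHl] hl; rewrite /call /= /dfs_body; first by ev_body.
have hI := hl st (mem_head _ _).
have {}IHl := IHl (fun st h => hl st (@mem_behead _ (_ :: l) st h)).
have {stepC} hdfs := stepC st hI; have hstep := call_step hI.
have hc : cSTEP + 500 + (2 * #|T| + 2) * cDFS #|T| (spine t) <= cDFS #|T| (spine t).+1.
  rewrite /cDFS expnS; have : 0 < (2 * #|T| + 3) ^ spine t by rewrite expn_gt0 addnS.
  by move: #|T| (_ + 500) (_ ^ _); clear=> a b c h; nia.
move: hc hstep hdfs IHl; rewrite /search_all /=; set x := cDFS _ _; set y := cDFS _ _.
case: st hI hl => U Z A [|w W] s c /= hI hl hc hstep hdfs IHl.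
  by ev_body; move: hc; clear; lia.
move: hdfs; rewrite -/(search_all _ _); case: (search_all _ _) => [z|] /= hdfs.
  by ev_body; move: hc; clear; lia.
by ev_body; move: hc; clear; lia.
Qed.
End Search.

(** * The running time *)

(** A base of at least 2 lets the exponent absorb constant factors. *)
Definition poly (f : nat -> nat) := exists c, forall n, f n <= n.+2 ^ c.

Lemma poly_const a : poly (fun=> a).
Proof.
exists a => n; apply: leq_trans (ltnW (ltn_expl a (isT : 1 < 2))) _.
by case: a => // a; rewrite leq_exp2r.
Qed.

Lemma poly_add f g : poly f -> poly g -> poly (fun n => f n + g n).
Proof.
move=> [a ha] [b hb]; exists (maxn a b).+1 => n.
apply: (@leq_trans (2 * n.+2 ^ maxn a b)); last by rewrite expnS leq_mul2r orbT.
rewrite mul2n -addnn leq_add //; [apply: leq_trans (ha n) _|apply: leq_trans (hb n) _];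
  by rewrite leq_exp2l // ?leq_maxl ?leq_maxr.
Qed.

Lemma poly_mul f g : poly f -> poly g -> poly (fun n => f n * g n).
Proof. by move=> [a ha] [b hb]; exists (a + b) => n; rewrite expnD leq_mul. Qed.

Lemma poly_size : poly (fun n => n.+2).
Proof. by exists 1 => n; rewrite expn1. Qed.

Ltac poly_tac :=
  first [assumption | exact: poly_size | exact: poly_const
        | apply: poly_add; poly_tac | apply: poly_mul; poly_tac].

Lemma poly_step : poly cSTEP.
Proof.
have hN := poly_size.
have hS f : poly f -> poly (fun n => (f n).+1).
  by move=> hf; have [c hc] := poly_add (poly_const 1) hf; exists c.
have h1 : poly cEQ by rewrite /cEQ; poly_tac.
have h2 : poly cMEM by rewrite /cMEM; poly_tac.
have h3 : poly cDIFF by rewrite /cDIFF; poly_tac.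
have h4 : poly cADJ by rewrite /cADJ; poly_tac.
have h5 : poly cNBR by rewrite /cNBR; poly_tac.
have h6 : poly cNBRS by rewrite /cNBRS; poly_tac.
have h7 : poly cPLACE by rewrite /cPLACE; poly_tac.
have h8 : poly cTRY by rewrite /cTRY; poly_tac.
have h9 : poly cRUN by rewrite /cRUN; apply: poly_mul; [apply: (hS (fun n => _)); poly_tac|poly_tac].
have h10 : poly cDELTA by rewrite /cDELTA; poly_tac.
have h11 : poly cCLOSE by rewrite /cCLOSE; poly_tac.
have h12 : poly cMOVE by rewrite /cMOVE; poly_tac.
have h13 : poly cMOVES by rewrite /cMOVES; poly_tac.
have h14 : poly cBRANCH by rewrite /cBRANCH; poly_tac.
by rewrite /cSTEP; poly_tac.
Qed.

Section Main.
Variables (n : nat) (e : rel 'I_n) (T : {set 'I_n}) (r s : nat).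
Notation N := n.+2.
Notation G := (tree_of_digraph e).

Lemma call_iota A (f : A -> tree) (l : seq A) i :
  call IOTA (Node (tn i) (tree_of_seq f l)) (tree_of_seq tn (iota i (size l)))
    (30 * (size l).+1).
Proof.
elim: l i => [|a l IH] i; rewrite /call /= /iota_body; first by ev_body.
by have {}IH := IH i.+1; ev_body.
Qed.

Definition cMAIN k := cDFS n k (5 * k) + 180 * N + 500.

Lemma run_main :
  ev [:: instance e T r s] main_body
    (tout (search e r (5 * #|T|) (init r (enum 'I_n) (enum T) s))) (cMAIN #|T|).
Proof.
have h1 : call IOTA (Node Leaf G) (tv (enum 'I_n)) (30 * N).
  apply: ev_conv (call_iota _ (enum 'I_n) 0) _ _.
    rewrite /tv /tree_of_vertices /tree_of_seq size_enum_ord -val_enum_ord.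
    by elim: (enum _) => //= x l ->.
  by rewrite size_enum_ord leq_mul2l leqW.
have hT : size (enum T) = #|T| by rewrite -cardE.
have happ l : size (enum T) < N -> call APP (Node (tv (enum T)) (tv l)) (tv (enum T ++ l)) (30 * N).
  move=> h; apply: ev_conv (call_app_seq _ _ _) _ _; first by [].
  by rewrite leq_mul2l.
have hTN : size (enum T) < N by rewrite hT ltnS leqW // -[n in X in _ <= X]card_ord max_card.
have h2 := happ (enum T) hTN; have h3 := happ _ hTN : call APP (Node _ (tv (enum T ++ enum T))) _ _.
have h4 := happ (enum T ++ enum T ++ enum T) hTN.
have h5 := happ (enum T ++ enum T ++ enum T ++ enum T) hTN.
pose st := init r (enum 'I_n) (enum T) s.
have hI : inv e T r s st.
  apply: inv_init; [exact: enum_uniq|by move=> x; rewrite mem_enum|exact: enum_uniq|].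
  by move=> x; rewrite mem_enum.
(* Five copies of the list of terminals serve as the fuel [5 * #|T|]. *)
pose t := tv (enum T ++ enum T ++ enum T ++ enum T ++ enum T).
have ht : spine t = 5 * #|T| by rewrite spine_seq !size_cat hT; clear; lia.
have h6 := @call_dfs n e T r s t [:: st].
have {}h6 : call DFS _ _ _ := h6 ltac:(by move=> st'; rewrite inE => /eqP ->).
rewrite /search_all /= ht mul1n in h6.
have {}h6 : call DFS (Node G (Node (tn r) (Node t (tsts [:: st]))))
    (tout (search e r (5 * #|T|) st)) (cDFS n #|T| (5 * #|T|) + 40).
  by apply: ev_conv h6 _ _ => //; case: (search _ _ _ _).
by rewrite /main_body; ev_body; rewrite /cMAIN; clear; lia.
Qed.

End Main.

(** For positive [k], the bound [k < 2 ^ (trunc_log 2 k).+1] gives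
    [2 * k + 3 <= 2 ^ (trunc_log 2 k + 4)]; for [k = 0] both exponents vanish. *)
Lemma search_time k : (2 * k + 3) ^ (5 * k) <= 2 ^ (5 * k * (trunc_log 2 k + 4)).
Proof.
rewrite mulnC [in X in _ <= X]mulnC [5 * k]mulnC mulnA !expnM leq_exp2r // -!expnM.
case: k => [|k] //; rewrite expnM leq_exp2r //.
have := trunc_log_ltn k.+1 (isT : 1 < 2); rewrite !expnS addnC !expnD.
by move: (2 ^ _); lia.
Qed.

Lemma bigO_search c : bigO_klogk (fun k => c + 5 * k * (trunc_log 2 k + 4)).
Proof.
(* From [k = 2] on the logarithm is positive, so [20 * k] and [c] are absorbed by multiples of
   [k * trunc_log 2 k]. *)
exists (c + 25), 2 => k hk; have : 0 < trunc_log 2 k by rewrite trunc_log_gt0.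
by move: (trunc_log _ _) => L hL; nia.
Qed.

(* maxn n 1 differs from n only for the empty digraph, where n ^ c = 0. *)
Theorem mainTheorem8 :
  exists (p : program) (f : nat -> nat) (c : nat),
    bigO_klogk f /\
    forall (n : nat) (e : rel 'I_n) (T : {set 'I_n}) (r s : nat),
      exists (out : tree) (t : nat),
        [/\ runs_in p (instance e T r s) out t,
            correct_output e T r s out
          & t <= 2 ^ f #|T| * maxn n 1 ^ c].
Proof.
have [c hc] : poly (fun n => cSTEP n + 500 + 180 * n.+2 + 500).
  have h := poly_step; do 3 (apply: poly_add; last by [exact: poly_const|poly_tac]).
  exact: h.
(* The summand [2 * c] comes from [n.+2 <= 4 * maxn n 1] raised to the power [c]. *)
exists prog, (fun k => 2 * c + 5 * k * (trunc_log 2 k + 4)), c.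
split=> [|n e T r s]; first exact: bigO_search.
have [t hrun ht] := run_main e T r s.
exists (tout (search e r (5 * #|T|) (init r (enum 'I_n) (enum T) s))), t; split=> //.
- have hU := enum_uniq 'I_n; have hT := enum_uniq T.
  have memU x : x \in enum 'I_n by rewrite mem_enum.
  have memT : enum T =i T by move=> x; rewrite mem_enum.
  have hI : inv e T r s (init r (enum 'I_n) (enum T) s) by apply: inv_init.
  case E: (search _ _ _ _) => [z|]; [left|right].
    have [hz1 hz2 hz3] := search_sound hI E.
    exists [set:: z], z; split=> //; first by rewrite card_seq.
    by apply: uniq_perm => // [|x]; rewrite ?enum_uniq // mem_enum inE.
  split=> // -[Z [hZ hs]].
  have : search e r (5 * #|T|) (init r (enum 'I_n) (enum T) s).
    by apply: search_init hZ hs => //; rewrite -cardE.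
  by rewrite E.
apply: leq_trans ht _; rewrite expnD mulnAC mulnC.
have h1 := search_time #|T|.
have h2 : n.+2 ^ c <= 2 ^ (2 * c) * maxn n 1 ^ c.
  rewrite expnM -expnMn; case: c {hc h1} => // c; rewrite leq_exp2r //.
  by rewrite (_ : 2 ^ 2 = 4) //; lia.
apply: leq_trans (leq_mul h1 h2); have := hc n; rewrite /cMAIN /cDFS.
(* The exponential factor is at least 1, so the additive terms of [cMAIN] can be multiplied by
   it. *)
have : 0 < (2 * #|T| + 3) ^ (5 * #|T|) by rewrite expn_gt0 addnS.
move: (_ ^ (5 * _)) (_ ^ c) (cSTEP n) => a b d ha hb; nia.
Qed.
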